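(* Let $M,N,m\ge1$ be integers. Let $L_1(n)=\Lambda+\sum_{i\ge0}a_i(n,\mathbf t)\Lambda^{-i}$, $L_2(n)=\sum_{i\ge-1}b_i(n,\mathbf t)\Lambda^{i}$ and let $q^{(i)}_n(\mathbf t)$, $r^{(i)}_n(\mathbf t)$ ($1\le i\le m$, $n\in\mathbb Z$) be functions such that, for all $p\ge1$, $a=1,2$, $1\le i\le m$, \begin{align*} &L_1^M(n)=L_2^{N}(n)+\sum_{j\in\mathbb Z}\sum_{l=1}^{m}q^{(l)}_n\Lambda^jr^{(l)}_{n+1},\\ &\partial_{t^{(1)}_p}L_a(n)=[(L_1^p(n))_{\ge0},L_a(n)],\qquad \partial_{t^{(2)}_p}L_a(n)=[(L_2^p(n))_{<0},L_a(n)],\\ &\partial_{t^{(1)}_p}q^{(i)}_n=\big(L_1^{p}(n)\big)_{\ge0}\big(q^{(i)}_n\big),\qquad \partial_{t^{(2)}_p}q^{(i)}_n=\big(L_2^{p}(n)\big)_{<0}\big(q^{(i)}_n\big),\\ &\partial_{t^{(1)}_p}r^{(i)}_n=-\Big(\big(L_1^{p}(n-1)\big)_{\ge0}\Big)^*\big(r^{(i)}_n\big),\qquad \partial_{t^{(2)}_p}r^{(i)}_n=-\Big(\big(L_2^{p}(n-1)\big)_{<0}\Big)^*\big(r^{(i)}_n\big). \end{align*} Let $\psi_a(n,\mathbf t,z)$ and $\psi_a^*(n,\mathbf t,z)$, $a=1,2$, be the Toda wave functions and adjoint wave functions associated with $(L_1,L_2)$ (defined in the context). Then for all $n',n''\in\mathbb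 Z$, all $\mathbf t',\mathbf t''$ and all $1\le i\le m$: \begin{align*} \sum_{l=1}^m q_{n'}^{(l)}(\mathbf t')\,r_{n''}^{(l)}(\mathbf t'') &=\oint_{C_R}\frac{dz}{2\pi \mathbf i}z^{M-1}\psi_1(n',\mathbf t',z)\psi_1^*(n'',\mathbf t'',z) -\oint_{C_r}\frac{dz}{2\pi \mathbf i}z^{-N-1}\psi_2(n',\mathbf t',z)\psi_2^*(n'',\mathbf t'',z),\\ q^{(i)}_{n'}(\mathbf t') &=-\oint_{C_R}\frac{dz}{2\pi \mathbf i}z^{-1}\psi_1(n',\mathbf t',z)\,\iota_{\Lambda}(\Lambda-1)^{-1}\Big(\psi_1^*(n''+1,\mathbf t'',z)q^{(i)}_{n''}(\mathbf t'')\Big)\\ &\quad+\oint_{C_r}\frac{dz}{2\pi \mathbf i}z^{-1}\psi_2(n',\mathbf t',z)\,\iota_{\Lambda^{-1}}(\Lambda-1)^{-1}\Big(\psi_2^*(n''+1,\mathbf t'',z)q^{(i)}_{n''}(\mathbf t'')\Big),\\ r^{(i)}_{n'}(\mathbf t') &=\oint_{C_R}\frac{dz}{2\pi \mathbf i}z^{-1}\psi_1^*(n',\mathbf t',z)\,\iota_{\Lambda^{-1}}(\Lambda-1)^{-1}\Big(\psi_1(n'',\mathbf t'',z)r^{(i)}_{n''+1}(\mathbf t'')\Big)\\ &\quad-\oint_{C_r}\frac{dz}{2\pi \mathbf i}z^{-1}\psi_2^*(n',\mathbf t',z)\,\iota_{\Lambda}(\Lambda-1)^{-1}\Big(\psi_2(n'',\mathbf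 t'',z)r^{(i)}_{n''+1}(\mathbf t'')\Big). \end{align*}
   Context: Variables: $\mathbf t=(t^{(1)},t^{(2)})$, $t^{(a)}=(t^{(a)}_1,t^{(a)}_2,\dots)$; functions of $\mathbf t$ are treated formally (e.g. as formal power series). $\xi(t,z)=\sum_{j\ge1}t_jz^j$. Shift operators: $\Lambda f(n)=f(n+1)$. For $A=\sum_ia_i(n)\Lambda^i$: $A_{\ge0}=\sum_{i\ge0}a_i\Lambda^i$, $A_{<0}=\sum_{i<0}a_i\Lambda^i$, $A^*=\sum_i\Lambda^{-i}a_i$, where functions are multiplication operators and $\Lambda^if(n)=f(n+i)\Lambda^i$; $A$ acts by $A(z^{\pm n})=\sum_ia_iz^{\pm(n+i)}$. $L_a(n-1)$ denotes $L_a(n)$ with $n$ replaced by $n-1$ in all coefficients. Equality of operators, including doubly infinite sums $\sum_{j\in\mathbb Z}c_j(n)\Lambda^j$, means equality of all coefficients. $\iota_\Lambda(\Lambda-1)^{-1}=-\sum_{i\ge0}\Lambda^i$ and $\iota_{\Lambda^{-1}}(\Lambda-1)^{-1}=\sum_{i\ge1}\Lambda^{-i}$; in the bilinear equations they act on the variable $n''$. Wave functions: let $S_1=1+\sum_{j\ge1}\omega_j(n,\mathbf t)\Lambda^{-j}$ and $S_2=\sum_{j\ge0}\nu_j(n,\mathbf t)\Lambda^j$ ($\nu_0$ invertible) be dressing operators of the Toda hierarchy, i.e. $L_1(n)=S_1\Lambda S_1^{-1}$, $L_2(n)=S_2\Lambda^{-1}S_2^{-1}$ and, for all $p\ge1$,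 $\partial_{t^{(1)}_p}S_1=-(L_1^p)_{<0}S_1$, $\partial_{t^{(2)}_p}S_1=(L_2^p)_{<0}S_1$, $\partial_{t^{(1)}_p}S_2=(L_1^p)_{\ge0}S_2$, $\partial_{t^{(2)}_p}S_2=-(L_2^p)_{\ge0}S_2$. Then $\psi_1(n,\mathbf t,z)=\big(S_1e^{\xi(t^{(1)},\Lambda)}\big)(z^n)$, $\psi_1^*(n+1,\mathbf t,z)=\big((S_1^{-1})^*e^{-\xi(t^{(1)},\Lambda^{-1})}\big)(z^{-n})$, $\psi_2(n,\mathbf t,z)=\big(S_2e^{\xi(t^{(2)},\Lambda^{-1})}\big)(z^n)$, $\psi_2^*(n+1,\mathbf t,z)=\big((S_2^{-1})^*e^{-\xi(t^{(2)},\Lambda)}\big)(z^{-n})$. Thus $\psi_1=z^n(\text{power series in }z^{-1})e^{\xi(t^{(1)},z)}$, $\psi_1^*=z^{-n+1}(\text{power series in }z^{-1})e^{-\xi(t^{(1)},z)}$, $\psi_2=z^n(\text{power series in }z)e^{\xi(t^{(2)},z^{-1})}$, $\psi_2^*=z^{-n+1}(\text{power series in }z)e^{-\xi(t^{(2)},z^{-1})}$. Contour integrals: $C_R$ (resp. $C_r$) is an anticlockwise circle around $0$ of sufficiently large (resp. small) radius. Formally both integrals mean ''take the coefficient of $z^{-1}$'', where for $C_R$ the factors multiplying the exponentials in $\psi_1$ and $\psi_1^*$ are expanded as $z^{n}$, resp. $z^{-n+1}$, times a power series in $z^{-1}$, and for $C_r$ the factors multiplying the exponentials in $\psi_2$ and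 $\psi_2^*$ are expanded as $z^{n}$, resp. $z^{-n+1}$, times a power series in $z$, with the product of the exponentials, e.g. $e^{\xi(t^{(1)'}-t^{(1)''},z)}$ or $e^{\xi(t^{(2)'}-t^{(2)''},z^{-1})}$, expanded as a formal power series in $\mathbf t'-\mathbf t''$. *)

(* Defs.v *)
From HB Require Import structures.
From mathcomp Require Import all_boot all_order all_algebra finmap.
From mathcomp.multinomials Require Import monalg.
From mathcomp Require Import all_classical.

Set Implicit Arguments.
Unset Strict Implicit.
Unset Printing Implicit Defensive.

Import Order.TTheory GRing.Theory Num.Theory.

Local Open Scope classical_set_scope.
Local Open Scope ring_scope.

(* Formal power series in the (possibly infinitely many) commuting variables
   indexed by I; a series is the family of its coefficients, indexed by the
   finitely supported exponents {cmonom I}. *)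

Record fps (I : choiceType) (A : Type) : Type := Fps { fcoef : {cmonom I} -> A }.

Arguments Fps {I A} _.
Arguments fcoef {I A} _ _.

HB.instance Definition _ (I : choiceType) (A : Type) := gen_eqMixin (fps I A).
HB.instance Definition _ (I : choiceType) (A : Type) :=
  gen_choiceMixin (fps I A).

Lemma fpsP (I : choiceType) (A : Type) (f g : fps I A) :
  (forall m, fcoef f m = fcoef g m) -> f = g.
Proof. by case: f g => [f] [g] /= fg; congr Fps; apply/funext. Qed.

Section FpsZmod.
Variables (I : choiceType) (A : zmodType).

Definition fps_zero : fps I A := Fps (fun=> 0).
Definition fps_opp (f : fps I A) : fps I A := Fps (fun m => - fcoef f m).
Definition fps_add (f g : fps I A) : fps I A :=
  Fps (fun m => fcoef f m + fcoef g m).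

Fact fps_addA : associative fps_add.
Proof. by move=> f g h; apply: fpsP => m /=; rewrite addrA. Qed.
Fact fps_addC : commutative fps_add.
Proof. by move=> f g; apply: fpsP => m /=; rewrite addrC. Qed.
Fact fps_add0 : left_id fps_zero fps_add.
Proof. by move=> f; apply: fpsP => m /=; rewrite add0r. Qed.
Fact fps_addN : left_inverse fps_zero fps_opp fps_add.
Proof. by move=> f; apply: fpsP => m /=; rewrite addNr. Qed.

HB.instance Definition _ := GRing.isZmodule.Build (fps I A)
  fps_addA fps_addC fps_add0 fps_addN.

End FpsZmod.

Section Antidiagonal.
Variable I : choiceType.
Implicit Types m d : {cmonom I}.

Definition antidiag m : set ({cmonom I} * {cmonom I}) :=
  [set p | mmul p.1 p.2 = m].

Lemma finite_mdiv m : finite_set [set d | exists e, mmul d e = m].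
Proof.
pose N := (mdeg m).+1.
pose mk (g : {ffun finsupp m -> 'I_N}) : {cmonom I} :=
  [cmonom (g i : nat) | i : finsupp m]%M.
apply: (@sub_finite_set _ _ (mk @` setT)); last first.
  by apply: finite_image; apply: finite_finset.
move=> d [e dem].
have dm i : (d i <= m i)%N by rewrite -dem cmM leq_addr.
have mN i : (m i < N)%N.
  rewrite /N ltnS mdegE; case: (mdomP m i) => // im.
  by rewrite (big_fsetD1 i) //= leq_addr.
exists [ffun i : finsupp m => Ordinal (leq_ltn_trans (dm (val i)) (mN (val i)))] => //.
apply/eqP/cmP => i; rewrite /mk cmE.
have [im|im] := boolP (i \in finsupp m).
  by rewrite (fsfun_ffun _ _) insubT /= ffunE.
rewrite (fsfun_ffun _ _) insubN //=.
move: (dm i); move: im; rewrite -cmE_eq0 => /eqP ->.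
by rewrite leqn0 => /eqP ->.
Qed.

Definition mdivs m : seq {cmonom I} :=
  enum_fset (fset_set [set d | exists e, mmul d e = m]).

Lemma mdivs_uniq m : uniq (mdivs m).
Proof. exact: fset_uniq. Qed.

Lemma mem_mdivs m d e : mmul d e = m -> d \in mdivs m.
Proof.
move=> dem; rewrite /mdivs -[_ \in _]/(d \in fset_set _).
by rewrite in_fset_set ?inE /=; [exists e|exact: finite_mdiv].
Qed.

End Antidiagonal.

Section FpsRing.
Variables (I : choiceType) (A : comNzRingType).
Implicit Types (f g h : fps I A) (m : {cmonom I}).

Definition fps_one : fps I A := Fps (fun m => (m == mone)%:R).
Definition fps_mul f g : fps I A :=
  Fps (fun m => \sum_(p \in antidiag m) fcoef f p.1 * fcoef g p.2).

Lemma fps_mulE (r : seq {cmonom I}) f g m : uniq r ->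
  (forall d e, mmul d e = m -> d \in r) ->
  fcoef (fps_mul f g) m =
  \sum_(d <- r) \sum_(e <- r)
     (if mmul d e == m then fcoef f d * fcoef g e else 0).
Proof.
move=> ru rm /=.
pose rr := [seq (d, e) | d <- r, e <- r].
rewrite (@fsbigE _ _ _ _ (antidiag m) [seq p <- rr | mmul p.1 p.2 == m]).
- rewrite big_filter_cond.
  rewrite (eq_bigl (fun p => mmul p.1 p.2 == m)); last first.
    move=> p; case: eqP => //= pm; exact: mem_set.
  by rewrite big_mkcond /= /rr big_allpairs_dep.
- by rewrite filter_uniq // allpairs_uniq // => -[a b] [c d].
- by move=> p /=; rewrite mem_filter => /andP[/eqP].
- move=> [d e] /= dem; rewrite mem_filter dem eqxx /= => /negP[].
  apply/allpairsP; exists (d, e); split => //=; first exact: rm dem.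
  by apply: (rm e d); rewrite mulmC.
Qed.

Let mE m f g := fps_mulE f g (mdivs_uniq m) (@mem_mdivs I m).

Fact fps_mulC : commutative fps_mul.
Proof.
move=> f g; apply: fpsP => m; rewrite !mE exchange_big /=.
apply: eq_bigr => d _; apply: eq_bigr => e _.
by rewrite mulmC [fcoef f _ * _]mulrC.
Qed.

Fact fps_mul1 : left_id fps_one fps_mul.
Proof.
move=> f; apply: fpsP => m; rewrite mE.
have h1 : mone \in mdivs m by apply: (@mem_mdivs _ m mone m); rewrite mul1m.
have hm : m \in mdivs m by apply: (@mem_mdivs _ m m mone); rewrite mulm1.
rewrite (bigD1_seq mone) ?mdivs_uniq //= [X in _ + X]big1 ?addr0; last first.
  move=> d /negPf d1; rewrite big1 // => e _.
  by case: ifP => // _; rewrite d1 mul0r.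
rewrite (bigD1_seq m) ?mdivs_uniq //= [X in _ + X]big1 ?addr0; last first.
  by move=> e /negPf em; rewrite mul1m em.
by rewrite mul1m !eqxx mul1r.
Qed.

Fact fps_mulDl : left_distributive fps_mul +%R.
Proof.
move=> f g h; apply: fpsP => m.
rewrite -[RHS]/(fcoef (fps_mul f h) m + fcoef (fps_mul g h) m) !mE -big_split /=.
apply: eq_bigr => d _; rewrite -big_split /=; apply: eq_bigr => e _.
by case: ifP => _; rewrite ?addr0 // mulrDl.
Qed.

Let mul3E f g h m (r := mdivs m) :
  fcoef (fps_mul (fps_mul f g) h) m =
  \sum_(a <- r) \sum_(b <- r) \sum_(c <- r)
    (if mmul (mmul a b) c == m
     then fcoef f a * fcoef g b * fcoef h c else 0).
Proof.
have ru : uniq r by exact: mdivs_uniq.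
have rm d e : mmul d e = m -> d \in r by exact: mem_mdivs.
rewrite mE -/r.
transitivity (\sum_(u <- r) \sum_(c <- r) \sum_(a <- r) \sum_(b <- r)
  (if (mmul u c == m) && (mmul a b == u)
   then fcoef f a * fcoef g b * fcoef h c else 0)).
  apply: eq_bigr => u _; apply: eq_bigr => c _.
  case: eqP => ucm; last by rewrite big1 // => a _; rewrite big1.
  rewrite (@fps_mulE r) //; last first.
    by move=> d e deu; apply: (rm d (mmul e c)); rewrite mulmA deu.
  rewrite mulr_suml; apply: eq_bigr => a _; rewrite mulr_suml.
  by apply: eq_bigr => b _; case: ifP => _ //; rewrite mul0r.
under eq_bigr do rewrite exchange_big /=.
rewrite exchange_big /=; apply: eq_bigr => a _.
under eq_bigr do rewrite exchange_big /=.
rewrite exchange_big /=; apply: eq_bigr => b _.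
rewrite exchange_big /=; apply: eq_bigr => c _.
case: (eqVneq (mmul (mmul a b) c) m) => abcm; last first.
  rewrite big1 // => u _; case: ifP => // /andP[/eqP ucm /eqP abu].
  by case/eqP: abcm; rewrite abu.
rewrite (bigD1_seq (mmul a b)) ?(rm _ c) //= abcm !eqxx /= big1 ?addr0 //.
by move=> u /negPf uab; rewrite [_ == u]eq_sym uab andbF.
Qed.

Fact fps_mulA : associative fps_mul.
Proof.
move=> f g h; apply: fpsP => m; rewrite [fps_mul f _]fps_mulC !mul3E.
under eq_bigr do rewrite exchange_big /=.
rewrite exchange_big /=; apply: eq_bigr => a _.
apply: eq_bigr => b _; apply: eq_bigr => c _.
rewrite [mmul (mmul b c) a]mulmC mulmA; case: ifP => // _.
by rewrite [RHS]mulrAC -mulrA [RHS]mulrC [fcoef f a * _]mulrC mulrA.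
Qed.

Fact fps_one_neq0 : fps_one != 0.
Proof.
apply/eqP => /(congr1 (fun f => fcoef f mone)) /= /eqP.
by rewrite eqxx oner_eq0.
Qed.

HB.instance Definition _ := GRing.Zmodule_isComNzRing.Build (fps I A)
  fps_mulA fps_mulC fps_mul1 fps_mulDl fps_one_neq0.

Definition fps_scale (c : A) f : fps I A := Fps (fun m => c * fcoef f m).

Fact fps_scaleA a b f : fps_scale a (fps_scale b f) = fps_scale (a * b) f.
Proof. by apply: fpsP => m /=; rewrite mulrA. Qed.
Fact fps_scale1 : left_id 1 fps_scale.
Proof. by move=> f; apply: fpsP => m /=; rewrite mul1r. Qed.
Fact fps_scaleDr : right_distributive fps_scale +%R.
Proof. by move=> a f g; apply: fpsP => m /=; rewrite mulrDr. Qed.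
Fact fps_scaleDl f : {morph fps_scale^~ f : a b / a + b}.
Proof. by move=> a b; apply: fpsP => m /=; rewrite mulrDl. Qed.

HB.instance Definition _ := GRing.Zmodule_isLmodule.Build A (fps I A)
  fps_scaleA fps_scale1 fps_scaleDr fps_scaleDl.

Definition fps_unit f : bool := `[< exists g, g * f = 1 >].
Definition fps_inv f : fps I A :=
  if pselect (exists g, g * f = 1) is left ex then sval (cid ex) else f.

Fact fps_mulV : {in fps_unit, left_inverse 1 fps_inv *%R}.
Proof.
move=> f; rewrite unfold_in => /asboolP ex; rewrite /fps_inv.
by case: pselect => // ?; case: cid.
Qed.
Fact fps_unitP f g : g * f = 1 -> fps_unit f.
Proof. by move=> gf; apply/asboolP; exists g. Qed.
Fact fps_inv_out : {in [predC fps_unit], fps_inv =1 id}.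
Proof.
move=> f; rewrite !inE => /asboolP nex; rewrite /fps_inv.
by case: pselect.
Qed.

HB.instance Definition _ := GRing.ComNzRing_hasMulInverse.Build (fps I A)
  fps_mulV fps_unitP fps_inv_out.

Definition fps_var (i : I) : fps I A := Fps (fun m => (m == ucm i)%:R).

Definition fps_deriv (i : I) f : fps I A :=
  Fps (fun m => fcoef f (mmul m (ucm i)) *+ (m i).+1).

(* Sum of a family of series converging coefficientwise, i.e. in which every
   monomial receives finitely many nonzero contributions (a coefficient that
   receives infinitely many is set to 0 by the finitely supported sum). *)
Definition fps_sum (J : choiceType) (F : J -> fps I A) : fps I A :=
  Fps (fun m => \sum_(j \in [set: J]) fcoef (F j) m).

End FpsRing.

Arguments fps_var {I A} i.

(* inl j stands for t^(1)_(j+1) and inr j for t^(2)_(j+1). *)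
Definition tvar : Type := (nat + nat)%type.
HB.instance Definition _ := Choice.on tvar.

(* Indexed by p >= 1; the value at p = 0 is irrelevant. *)
Definition t1 (p : nat) : tvar := inl p.-1.
Definition t2 (p : nat) : tvar := inr p.-1.

Section Operators.
Variable K : fieldType.

Local Notation tfun := (fps tvar K).

(* A k n is the coefficient a_k(n) of Lambda^k in A = sum_k a_k(n) Lambda^k;
   no support condition is built in. *)
Definition op : Type := int -> int -> tfun.
HB.instance Definition _ := GRing.Zmodule.copy op (int -> int -> tfun).

Implicit Types (A B S : op) (f : int -> tfun).

Definition shift_op (j : int) : op := fun k _ => (k == j)%:R.

(* (a_i(n) Lambda^i)(b_j(n) Lambda^j) = a_i(n) b_j(n+i) Lambda^(i+j) *)
Definition op_mul A B : op :=
  fun k n => fps_sum (fun i : int => A i n * B (k - i) (n + i)).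

Definition op_pow A (p : nat) : op := iter p (op_mul A) (shift_op 0).

Definition op_comm A B : op := op_mul A B - op_mul B A.

Definition op_ge0 A : op := fun k n => if 0 <= k then A k n else 0.
Definition op_lt0 A : op := fun k n => if k < 0 then A k n else 0.

(* A^* = sum_i Lambda^(-i) a_i(n) = sum_i a_i(n-i) Lambda^(-i) *)
Definition op_adj A : op := fun k n => A (- k) (n + k).

Definition op_translate (c : int) A : op := fun k n => A k (n + c).

Definition op_act A f : int -> tfun :=
  fun n => fps_sum (fun i : int => A i n * f (n + i)).

Definition op_deriv (v : tvar) A : op := fun k n => fps_deriv v (A k n).

(* sum_(j in Z) q_n Lambda^j r_(n+1), where
   q_n Lambda^j r_(n+1) = q_n r_(n+1+j) Lambda^j *)
Definition op_biinf (q r : int -> tfun) : op := fun k n => q n * r (n + 1 + k).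

Definition op_lower : set op := [set A | forall k n, 0 < k -> A k n = 0].
Definition op_upper : set op := [set A | forall k n, k < 0 -> A k n = 0].

(* The inverse of S inside the class D (op_lower or op_upper): an element of D
   whose leading coefficient is invertible has exactly one such inverse. *)
Definition op_inv (D : set op) S : op :=
  xget 0 [set T | [/\ D T, op_mul S T = shift_op 0 & op_mul T S = shift_op 0]].

Definition op_exp A : op :=
  fun k n => fps_sum (fun l : nat => (l`!%:R)^-1 *: op_pow A l k n).

(* xi(t, Lambda) and xi(t, Lambda^-1), for t = t^(1) or t^(2) selected by
   tv = inl or inr *)
Definition xi_op (tv : nat -> tvar) : op :=
  fun k _ => if k is Posz j.+1 then fps_var (tv j) else 0.
Definition xi_opV (tv : nat -> tvar) : op := fun k n => xi_op tv (- k) n.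

(* Formal distributions in z: F k is the coefficient of z^k. *)
Definition zdist : Type := int -> tfun.

(* A(z^n) = sum_i a_i(n) z^(n+i) and A(z^(-n)) = sum_i a_i(n) z^(-(n+i)) *)
Definition act_z A (n : int) : zdist := fun k => A (k - n) n.
Definition act_zV A (n : int) : zdist := fun k => A (- k - n) n.

Definition psi1 S (n : int) : zdist :=
  act_z (op_mul S (op_exp (xi_op inl))) n.
Definition psi1s S (n : int) : zdist :=
  act_zV (op_mul (op_adj (op_inv op_lower S)) (op_exp (- xi_opV inl))) (n - 1).
Definition psi2 S (n : int) : zdist :=
  act_z (op_mul S (op_exp (xi_opV inr))) n.
Definition psi2s S (n : int) : zdist :=
  act_zV (op_mul (op_adj (op_inv op_upper S)) (op_exp (- xi_op inr))) (n - 1).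

(* iota_Lambda (Lambda-1)^-1 = - sum_(i >= 0) Lambda^i and
   iota_(Lambda^-1) (Lambda-1)^-1 = sum_(i >= 1) Lambda^(-i) *)
Definition iotaL (F : int -> zdist) (n : int) : zdist :=
  fun k => - fps_sum (fun i : nat => F (n + i%:Z) k).
Definition iotaLV (F : int -> zdist) (n : int) : zdist :=
  fun k => fps_sum (fun i : nat => F (n - i.+1%:Z) k).

(* Series in two independent sets of times t', t'': F m' m'' is the coefficient
   of t'^m' t''^m''. *)
Definition tfun2 : Type := {cmonom tvar} -> {cmonom tvar} -> K.
HB.instance Definition _ :=
  GRing.Zmodule.copy tfun2 ({cmonom tvar} -> {cmonom tvar} -> K).

(* f(t') g(t'') *)
Definition tens (f g : tfun) : tfun2 := fun m' m'' => fcoef f m' * fcoef g m''.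

(* F(t', z) G(t'', z) *)
Definition zmul2 (F G : zdist) : int -> tfun2 :=
  fun k m' m'' => \sum_(i \in [set: int]) tens (F i) (G (k - i)) m' m''.

(* The coefficient of z^-1 in z^a F(t', z) G(t'', z). For the wave functions
   the expansions prescribed on C_R and on C_r are those of F and G, so both
   contour integrals are given by this one formula. *)
Definition zres (a : int) (F G : zdist) : tfun2 := zmul2 F G (-1 - a).

End Operators.

(* Main.v *)
(* An operator [A] is handled as the Z x Z matrix whose (n, p) entry is the
   coefficient of Lambda^(p - n) at n. Then psi_a is the matrix
   W_a = S_a e^xi and psi_a^* (up to a shift) the matrix V_a = e^(-xi) S_a^-1,
   and with B_v standing for (L_1^p)_(>= 0) or (L_2^p)_(< 0),
     d_v W_a = B_v W_a,   d_v V_a = - V_a B_v,   d_v q = B_v q,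
     d_v r_(n+1) = - r_(n+1) B_v.
   Both sides of each identity thus solve the same linear equations in t' and
   in t''. In characteristic 0 a formal solution is determined by its constant
   term, so it suffices to compare at t' = t'' = 0, where e^xi = 1 and the first
   identity is the constraint L_1^M = L_2^N + sum q Lambda^j r. The same
   argument gives the Toda identity W_1(t') V_1(t'') = W_2(t') V_2(t''). The
   right-hand side of the second identity is this common matrix applied to
   q(t''), with the sum over Z cut at n''; its t''-derivative vanishes. The
   third identity is the second one for the transposed matrices. *)

Require Import Defs.
From HB Require Import structures.
From mathcomp Require Import all_boot all_order all_algebra finmap.
From mathcomp.multinomials Require Import monalg.
From mathcomp Require Import all_classical.
From mathcomp Require Import zify.

Set Implicit Arguments.
Unset Strict Implicit.
Unset Printing Implicit Defensive.

Import Order.TTheory GRing.Theory Num.Theory.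

Local Open Scope ring_scope.

(** * Formal series filtered by the weight of the times *)

(* The p-th time has weight p: modulo times of weight > d, the operators
   e^xi(t, Lambda) and e^xi(t, Lambda^-1) then have finite order. *)
Definition vwt (v : tvar) : nat := match v with inl j | inr j => j.+1 end.

Definition wt (m : {cmonom tvar}) : nat :=
  (\sum_(v <- finsupp m) m v * vwt v)%N.

Lemma wtEw (m : {cmonom tvar}) (D : {fset tvar}) :
  (finsupp m `<=` D)%fset -> wt m = (\sum_(v <- D) m v * vwt v)%N.
Proof.
move=> mD; by rewrite /wt (big_fset_incl _ mD) // => v _; rewrite -cmE_eq0 => /eqP ->.
Qed.

Lemma wtM m1 m2 : wt (mmul m1 m2) = (wt m1 + wt m2)%N.
Proof.
rewrite {1}/wt mdomD (wtEw (fsubsetUl _ (finsupp m2))).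
rewrite (wtEw (fsubsetUr (finsupp m1) _)) -big_split /=.
by apply: eq_bigr => v _; rewrite cmM mulnDl.
Qed.

Lemma wtU v : wt (ucm v) = vwt v.
Proof. by rewrite /wt mdomU big_seq_fset1 cmUU mul1n. Qed.

Lemma wt1 : wt mone = 0%N.
Proof. by rewrite /wt mdom1 big_seq_fset0. Qed.

(** * Coefficientwise convergent sums and derivations *)

Section FpsSum.
Variable K : fieldType.
Local Notation tfun := (fps tvar K).
Implicit Types (f g h : tfun) (d : nat) (m : {cmonom tvar}).

(** Congruence modulo the series of weight above [d]. The infinite sums met below are finite modulo
    each of these congruences, so identities are checked for every [d] and glued by [eqmodP]. *)
Definition eqmod d f g := forall m, (wt m <= d)%N -> fcoef f m = fcoef g m.

Lemma eqmodP f g : (forall d, eqmod d f g) -> f = g.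
Proof. by move=> fg; apply: fpsP => m; exact: (fg (wt m)). Qed.

Lemma eqmod_refl d f : eqmod d f f. Proof. by []. Qed.
#[local] Hint Resolve eqmod_refl : core.

Lemma eqmod_sym d f g : eqmod d f g -> eqmod d g f.
Proof. by move=> fg m md; rewrite fg. Qed.

Lemma eqmod_trans d f g h : eqmod d f g -> eqmod d g h -> eqmod d f h.
Proof. by move=> fg gh m md; rewrite fg // gh. Qed.

Lemma eqmodD d f f' g g' :
  eqmod d f f' -> eqmod d g g' -> eqmod d (f + g) (f' + g').
Proof. by move=> ff gg m md /=; rewrite -!/(fps_add _ _) /= ff // gg. Qed.

Lemma eqmodN d f f' : eqmod d f f' -> eqmod d (- f) (- f').
Proof. by move=> ff m md; rewrite -![- _]/(fps_opp _) /= ff. Qed.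

Lemma eqmodM d f f' g g' :
  eqmod d f f' -> eqmod d g g' -> eqmod d (f * g) (f' * g').
Proof.
move=> ff gg m md; rewrite -![_ * _]/(fps_mul _ _) /=.
apply: eq_fsbigr => -[a b]; rewrite inE /antidiag /= => abm.
have : (wt a + wt b <= d)%N by rewrite -wtM abm.
by move=> abd; rewrite ff ?gg //; lia.
Qed.

Lemma eqmodM0 d f g : eqmod d f 0 -> eqmod d (f * g) 0.
Proof. by move=> f0; rewrite -(mul0r g); apply: eqmodM. Qed.

Lemma eqmodM0r d f g : eqmod d g 0 -> eqmod d (f * g) 0.
Proof. by move=> g0; rewrite -(mulr0 f); apply: eqmodM. Qed.

Lemma eqmod_sum d (J : Type) (r : seq J) (F G : J -> tfun) :
  (forall j, eqmod d (F j) (G j)) ->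
  eqmod d (\sum_(j <- r) F j) (\sum_(j <- r) G j).
Proof.
by move=> FG; elim/big_ind2: _ => // *; exact: eqmodD.
Qed.

Lemma fcoefD f g m : fcoef (f + g) m = fcoef f m + fcoef g m.
Proof. by []. Qed.

Lemma fcoefB f g m : fcoef (f - g) m = fcoef f m - fcoef g m.
Proof. by []. Qed.

Lemma fcoefZ (c : K) f m : fcoef (c *: f) m = c * fcoef f m.
Proof. by []. Qed.

Lemma fcoef_fps_sum (J : choiceType) (F : J -> tfun) m :
  fcoef (fps_sum F) m = \sum_(j \in [set: J]) fcoef (F j) m.
Proof. by []. Qed.

Lemma fcoef_sum (J : Type) (r : seq J) (F : J -> tfun) m :
  fcoef (\sum_(j <- r) F j) m = \sum_(j <- r) fcoef (F j) m.
Proof. by elim/big_ind2: _ => // f x g y <- <-. Qed.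

Lemma fcoefM1 f g : fcoef (f * g) mone = fcoef f mone * fcoef g mone.
Proof.
rewrite (@fps_mulE _ _ [:: mone]) //; last first.
  by move=> a b /unitm[-> _]; rewrite inE.
by rewrite !big_seq1 mulm1 eqxx.
Qed.

Lemma fps_sum_eqmod d (J : choiceType) (r : seq J) (F : J -> tfun) :
  uniq r -> (forall j, j \notin r -> eqmod d (F j) 0) ->
  eqmod d (fps_sum F) (\sum_(j <- r) F j).
Proof.
move=> ru F0 m md; rewrite fcoef_sum /= (@fsbigE _ _ _ _ _ r) //.
  by apply: eq_bigl => j; rewrite in_setT.
by move=> j _ jr; rewrite F0.
Qed.

Lemma fps_sum_fin (J : choiceType) (r : seq J) (F : J -> tfun) :
  uniq r -> (forall j, j \notin r -> F j = 0) ->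
  fps_sum F = \sum_(j <- r) F j.
Proof.
by move=> ru F0; apply/eqmodP => d; apply: fps_sum_eqmod => // j /F0 ->.
Qed.

Lemma fps_sum0 (J : choiceType) (F : J -> tfun) :
  (forall j, F j = 0) -> fps_sum F = 0.
Proof. by move=> F0; rewrite (@fps_sum_fin _ [::]) ?big_nil. Qed.

Lemma eq_fps_sum (J : choiceType) (F G : J -> tfun) :
  F =1 G -> fps_sum F = fps_sum G.
Proof. by move/funext ->. Qed.

Lemma fps_sum_reindex (I J : choiceType) (h : I -> J) (F : J -> tfun) :
  bijective h -> fps_sum F = fps_sum (F \o h).
Proof.
by move=> bh; apply: fpsP => m /=; rewrite (@reindex_fsbigT _ _ _ I _ h).
Qed.

Lemma fps_sum_reindexD (j : int) (F : int -> tfun) :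
  fps_sum F = fps_sum (fun i => F (i - j)).
Proof.
by apply: fps_sum_reindex; exists (fun i => i + j) => i; rewrite ?addrK ?subrK.
Qed.

(** Up to each weight only finitely many terms survive, so for such a family the finitely supported
    sum in [fps_sum] never falls back to its default value 0. *)
Definition summable (J : choiceType) (F : J -> tfun) :=
  forall d, exists2 r : seq J, uniq r & forall j, j \notin r -> eqmod d (F j) 0.

Lemma fps_sumMr (J : choiceType) (F : J -> tfun) g :
  summable F -> fps_sum F * g = fps_sum (fun j => F j * g).
Proof.
move=> sF; apply/eqmodP => d; have [r ru F0] := sF d.
apply: (@eqmod_trans _ _ (\sum_(j <- r) F j * g)).
  by rewrite -mulr_suml; apply: eqmodM => //; exact: fps_sum_eqmod.
by apply/eqmod_sym/fps_sum_eqmod => // j /F0; exact: eqmodM0.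
Qed.

Lemma fps_sumMl (J : choiceType) (F : J -> tfun) g :
  summable F -> g * fps_sum F = fps_sum (fun j => g * F j).
Proof.
move=> sF; rewrite mulrC fps_sumMr //.
by apply: eq_fps_sum => j; rewrite mulrC.
Qed.

Lemma fps_sumD (J : choiceType) (F G : J -> tfun) :
  summable F -> summable G ->
  fps_sum (fun j => F j + G j) = fps_sum F + fps_sum G.
Proof.
move=> sF sG; apply/eqmodP => d; have [r ru F0] := sF d; have [s su G0] := sG d.
pose rs := undup (r ++ s).
have rsu : uniq rs by exact: undup_uniq.
have {}F0 j : j \notin rs -> eqmod d (F j) 0.
  by rewrite mem_undup mem_cat => /norP[/F0].
have {}G0 j : j \notin rs -> eqmod d (G j) 0.
  by rewrite mem_undup mem_cat => /norP[_ /G0].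
apply: (@eqmod_trans _ _ (\sum_(j <- rs) (F j + G j))).
  apply: fps_sum_eqmod => // j jrs; rewrite -[0]addr0.
  by apply: eqmodD; [exact: F0|exact: G0].
by rewrite big_split; apply: eqmodD; apply/eqmod_sym/fps_sum_eqmod.
Qed.

Lemma fps_sumN (J : choiceType) (F : J -> tfun) :
  fps_sum (fun j => - F j) = - fps_sum F.
Proof.
apply: fpsP => m /=.
rewrite (eq_fsbigr (fun j => -1 * fcoef (F j) m)) ?mulN1r //; last first.
  by move=> j _; rewrite mulN1r.
by rewrite -mulr_fsumr mulN1r.
Qed.

(** Modulo weight above [d], both iterated sums reduce to the same finite double sum over [r] and
    [s]. *)
Lemma fps_sum_exchange (I J : choiceType) (F : I -> J -> tfun) :
  (forall d, exists r s, [/\ uniq r, uniq s & forall i j,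
     (i \notin r) || (j \notin s) -> eqmod d (F i j) 0]) ->
  fps_sum (fun i => fps_sum (F i)) = fps_sum (fun j => fps_sum (F^~ j)).
Proof.
move=> sF; apply/eqmodP => d; have [r [s [ru su F0]]] := sF d.
have sum0 (T : choiceType) (G : T -> tfun) :
    (forall j, eqmod d (G j) 0) -> eqmod d (fps_sum G) 0.
  move=> G0; have := @fps_sum_eqmod d T [::] G isT; rewrite big_nil; exact.
apply: (@eqmod_trans _ _ (\sum_(i <- r) \sum_(j <- s) F i j)).
  apply: (@eqmod_trans _ _ (\sum_(i <- r) fps_sum (F i))).
    apply: fps_sum_eqmod => // i ir; apply: sum0 => j; apply: F0.
    by rewrite ir.
  apply: eqmod_sum => i; apply: fps_sum_eqmod => // j js; apply: F0.
  by rewrite js orbT.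
rewrite exchange_big /=.
apply/eqmod_sym; apply: (@eqmod_trans _ _ (\sum_(j <- s) fps_sum (F^~ j))).
  apply: fps_sum_eqmod => // j js; apply: sum0 => i; apply: F0.
  by rewrite js orbT.
apply: eqmod_sum => i; apply: fps_sum_eqmod => // j js; apply: F0.
by rewrite js.
Qed.

Lemma eqmod_deriv d v f g :
  eqmod (d + vwt v) f g -> eqmod d (fps_deriv v f) (fps_deriv v g).
Proof. by move=> fg m md /=; rewrite fg // wtM wtU leq_add2r. Qed.

Lemma fps_derivD v f g : fps_deriv v (f + g) = fps_deriv v f + fps_deriv v g.
Proof. by apply: fpsP => m /=; rewrite mulrnDl. Qed.

Lemma fps_derivN v f : fps_deriv v (- f) = - fps_deriv v f.
Proof. by apply: fpsP => m /=; rewrite mulNrn. Qed.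

Lemma fps_deriv0 v : fps_deriv v (0 : tfun) = 0.
Proof. by apply: fpsP => m /=; rewrite mul0rn. Qed.

Lemma fps_derivZ v c f : fps_deriv v (c *: f) = c *: fps_deriv v f.
Proof. by apply: fpsP => m /=; rewrite mulrnAr. Qed.

Lemma fps_deriv_bigsum v (J : Type) (r : seq J) (F : J -> tfun) :
  fps_deriv v (\sum_(j <- r) F j) = \sum_(j <- r) fps_deriv v (F j).
Proof. exact: (big_morph _ (fps_derivD v) (fps_deriv0 v)). Qed.

Lemma fps_deriv_sum v (J : choiceType) (F : J -> tfun) : summable F ->
  fps_deriv v (fps_sum F) = fps_sum (fun j => fps_deriv v (F j)).
Proof.
move=> sF; apply/eqmodP => d; have [r ru F0] := sF (d + vwt v)%N.
apply: (@eqmod_trans _ _ (\sum_(j <- r) fps_deriv v (F j))).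
  by rewrite -fps_deriv_bigsum; apply/eqmod_deriv/fps_sum_eqmod.
apply/eqmod_sym/fps_sum_eqmod => // j /F0 Fj0.
by rewrite -(fps_deriv0 v); apply: eqmod_deriv.
Qed.

Lemma mulcmIr v : injective (mmul^~ (ucm v) : {cmonom tvar} -> _).
Proof.
move=> a b /= ab; apply/eqP/cmP => i.
have := congr1 (fun m : {cmonom tvar} => m i) ab; rewrite !cmM; exact: addIn.
Qed.

Lemma mulcm_ucmP m v : m v != 0%N -> exists m', m = mmul m' (ucm v).
Proof.
move=> mv; exists (divcm m (ucm v)); apply/eqP/cmP => i.
rewrite cmM /divcm cmE fsfun_fun ucmE; case: eqP => [<-|_].
  by rewrite -cmE_neq0 mv subnK // lt0n.
rewrite addn0 subn0; case: ifP => // /negbT.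
by rewrite -cmE_eq0 => /eqP.
Qed.

(** Both sides become sums over the factorizations [mmul a b] of [mmul m u]. The derivative of [f]
    contributes with multiplicity [a v], that of [g] with [b v], and these add up to the exponent
    [(m v).+1]. *)
Lemma fps_derivM v f g :
  fps_deriv v (f * g) = fps_deriv v f * g + f * fps_deriv v g.
Proof.
apply: fpsP => m.
pose u := ucm v; pose r := mdivs (mmul m u).
have ru : uniq r by exact: mdivs_uniq.
have rP a b : mmul a b = mmul m u -> a \in r by exact: mem_mdivs.
have key (f' g' : tfun) : fcoef (fps_deriv v f' * g') m =
    \sum_(a <- r) \sum_(b <- r)
      (if mmul a b == mmul m u then (fcoef f' a *+ a v) * fcoef g' b else 0).
  pose G a := \sum_(b <- r) (if mmul a b == mmul m u
                 then (fcoef f' a *+ a v) * fcoef g' b else 0).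
  have cover a : a \notin r -> G a = 0.
    move=> ar; rewrite /G big1 // => b _; case: eqP => // /rP.
    by rewrite (negPf ar).
  pose s := mdivs m.
  have su : uniq [seq mmul a u | a <- s].
    by rewrite map_inj_uniq ?mdivs_uniq //; exact: mulcmIr.
  have sP a b : mmul a b = m -> a \in s by exact: mem_mdivs.
  transitivity (\sum_(a <- [seq mmul a u | a <- s]) G a); last first.
    transitivity (\sum_(a \in [set: {cmonom tvar}]) G a).
      rewrite (@fsbigE _ _ _ _ _ [seq mmul a u | a <- s]) //.
        by apply: eq_bigl => a; rewrite in_setT.
      move=> a _ aNs; rewrite /G big1 // => b _; case: eqP => // abm.
      (* A monomial [a] outside the list is not a multiple of [u], but then its multiplicity [a v]
         is 0. *)
      have [->|/mulcm_ucmP[a' aE]] := eqVneq (a v) 0%N.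
        by rewrite mulr0n mul0r.
      case/negP: aNs; rewrite aE; apply: (map_f (mmul^~ u)); apply: (sP _ b).
      apply: (@mulcmIr v).
      by rewrite -abm aE -!mulmA [mmul b _]mulmC.
    rewrite (@fsbigE _ _ _ _ _ r) //.
      by apply: eq_bigl => a; rewrite in_setT.
    by move=> a _ /cover.
  rewrite big_map (@fps_mulE _ _ s) //; last exact: mdivs_uniq.
  rewrite big_seq [RHS]big_seq; apply: eq_bigr => a ain; rewrite /G.
  have aE b : (mmul (mmul a u) b == mmul m u) = (mmul a b == m).
    by rewrite -mulmA [mmul u b]mulmC mulmA (inj_eq (@mulcmIr v)).
  under [RHS]eq_bigr => b _ do rewrite aE cmM cmUU addn1.
  transitivity (\sum_(b \in [set: {cmonom tvar}]) (if mmul a b == m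
     then fcoef (fps_deriv v f') a * fcoef g' b else 0)).
    rewrite (@fsbigE _ _ _ _ _ s) ?mdivs_uniq //.
      by apply: eq_bigl => b; rewrite in_setT.
    by move=> b _ bs; case: eqP => //; rewrite mulmC => /sP; rewrite (negPf bs).
  rewrite (@fsbigE _ _ _ _ _ r) //.
    by apply: eq_bigl => b; rewrite in_setT.
  move=> b _ br; case: eqP => // abm; case/negP: br.
  by apply: (rP _ (mmul u a)); rewrite -abm [mmul u a]mulmC
     mulmA [mmul b a]mulmC.
rewrite fcoefD key [f * fps_deriv _ _]mulrC key.
transitivity (fcoef (fps_mul f g) (mmul m u) *+ (m v).+1); first by [].
rewrite (@fps_mulE _ _ r) //.
rewrite -sumrMnl [X in _ + X]exchange_big -big_split /=; apply: eq_bigr => a _.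
rewrite -sumrMnl -big_split /=; apply: eq_bigr => b _.
rewrite [mmul b a]mulmC; case: eqP => [abm|_]; last by rewrite mul0rn addr0.
have -> : (m v).+1 = (a v + b v)%N by rewrite -cmM abm cmM cmUU addn1.
by rewrite mulrnDr mulrnAl mulrnAl [fcoef g b * _]mulrC.
Qed.

End FpsSum.

(** * Operators of locally bounded order *)

Section OpTheory.
Variable K : fieldType.
Local Notation tfun := (fps tvar K).
Implicit Types (A B C : op K) (s : bool) (f g : tfun) (d : nat).

Lemma opP A B : (forall k n, A k n = B k n) -> A = B.
Proof. by move=> AB; apply/funext => k; apply/funext. Qed.

Lemma fps_scaleAl (c : K) f g : c *: f * g = c *: (f * g).
Proof.
apply: fpsP => m; rewrite -[_ * g]/(fps_mul _ g) -[f * g]/(fps_mul f g) /=.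
by rewrite mulr_fsumr; apply: eq_fsbigr => p _; rewrite mulrA.
Qed.

Definition ints (R : nat) : seq int :=
  [seq x%:Z - R%:Z | x <- iota 0 (2 * R).+1].

Lemma ints_uniq R : uniq (ints R).
Proof.
rewrite map_inj_uniq ?iota_uniq // => x y.
by move/addIr => [].
Qed.

Lemma mem_ints R i : (i \in ints R) = (absz i <= R)%N.
Proof.
apply/mapP/idP => [[x]|iR]; first by rewrite mem_iota => + ->; lia.
by exists (absz (i + R%:Z)); rewrite ?mem_iota; lia.
Qed.

Definition dir s (k : int) : int := if s then k else - k.

(* Operators of this kind compose without convergence problems. The direction
   [true] is that of Lambda, [false] that of Lambda^-1. *)
Definition bnd s A :=
  forall d, exists c : nat, forall k n, c%:Z < dir s k -> eqmod d (A k n) 0.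

(** Up to each weight only finitely many powers of Lambda remain, so a banded operator can be
    applied to arbitrary functions of n and multiplied on the right by arbitrary operators. *)
Definition band A := bnd true A /\ bnd false A.

Lemma summable_mul s A B k n :
  bnd s A -> bnd s B -> summable (fun i : int => A i n * B (k - i) (n + i)).
Proof.
move=> bA bB d; have [a Aa] := bA d; have [b Bb] := bB d.
exists (ints (a + b + absz k)); first exact: ints_uniq.
move=> i; rewrite mem_ints => iR.
have [ai|ai] := ltP a%:Z (dir s i); first exact/eqmodM0/Aa.
apply/eqmodM0r/Bb; move: ai iR; rewrite /dir; case: s {bA bB Aa Bb}; lia.
Qed.

Lemma summable_band A n (f : int -> tfun) :
  band A -> summable (fun i : int => A i n * f i).
Proof.
move=> [bA bA'] d; have [a Aa] := bA d; have [b Ab] := bA' d.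
exists (ints (a + b)); first exact: ints_uniq.
move=> i; rewrite mem_ints => iR; apply/eqmodM0.
have [ai|ai] := ltP a%:Z i; first exact: Aa.
by apply: Ab; rewrite /=; lia.
Qed.

Lemma bndM s A B : bnd s A -> bnd s B -> bnd s (op_mul A B).
Proof.
move=> bA bB d; have [a Aa] := bA d; have [b Bb] := bB d.
exists (a + b)%N => k n kab m md /=; rewrite fsbig1 // => i _.
have [ai|ai] := ltP a%:Z (dir s i); first exact: (eqmodM0 _ (Aa _ _ ai) md).
have bi : b%:Z < dir s (k - i).
  by move: ai kab; rewrite /dir; case: s {bA bB Aa Bb}; lia.
exact: (eqmodM0r _ (Bb _ _ bi) md).
Qed.

Lemma bndD s A B : bnd s A -> bnd s B -> bnd s (A + B).
Proof.
move=> bA bB d; have [a Aa] := bA d; have [b Bb] := bB d.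
exists (a + b)%N => k n kab; rewrite -[0]addr0.
by apply: eqmodD; [apply: Aa|apply: Bb]; lia.
Qed.

Lemma bndN s A : bnd s A -> bnd s (- A).
Proof.
move=> bA d; have [a Aa] := bA d.
by exists a => k n ka; rewrite -[0]oppr0; apply/eqmodN/Aa.
Qed.

Lemma bndB s A B : bnd s A -> bnd s B -> bnd s (A - B).
Proof. by move=> bA /bndN; exact: bndD. Qed.

Lemma bnd0 s : bnd s 0.
Proof. by move=> d; exists 0%N. Qed.

Lemma bnd_shift s j : bnd s (shift_op K j).
Proof.
move=> d; exists (absz j) => k n; rewrite /shift_op /dir.
by case: eqP => [->|_ _] //; case: s; lia.
Qed.

Lemma bnd_deriv s v A : bnd s A -> bnd s (op_deriv v A).
Proof.
move=> bA d; have [a Aa] := bA (d + vwt v)%N.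
exists a => k n ka; rewrite -(fps_deriv0 K v).
exact/eqmod_deriv/Aa.
Qed.

Lemma bnd_adj s A : bnd s A -> bnd (~~ s) (op_adj A).
Proof.
move=> bA d; have [a Aa] := bA d.
by exists a => k n ka; apply: Aa; case: s ka {bA}; rewrite /dir /=; lia.
Qed.

(** The three orders [j], [i - j] and [k - i] are bounded above in the same direction [s] while
    their sum is [k]. Hence [i] and [j] stay in a finite box and the two sums can be exchanged. *)
Lemma op_mulA s A B C : bnd s A -> bnd s B -> bnd s C ->
  op_mul (op_mul A B) C = op_mul A (op_mul B C).
Proof.
move=> bA bB bC; apply: opP => k n.
pose F i j := A j n * B (i - j) (n + j) * C (k - i) (n + i).
transitivity (fps_sum (fun i => fps_sum (F i))).
  apply: eq_fps_sum => i; rewrite fps_sumMr //; exact: summable_mul bA bB.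
rewrite fps_sum_exchange; last first.
  move=> d; have [a Aa] := bA d; have [b Bb] := bB d; have [c Cc] := bC d.
  exists (ints (a + b + c + absz k)), (ints (a + b + c + absz k)).
  split=> [||i j]; rewrite ?ints_uniq // !mem_ints => ijR; rewrite /F.
  have [aj|aj] := ltP a%:Z (dir s j); first exact/eqmodM0/eqmodM0/Aa.
  have [bj|bj] := ltP b%:Z (dir s (i - j)); first exact/eqmodM0/eqmodM0r/Bb.
  apply/eqmodM0r/Cc; move: aj bj ijR; rewrite /dir.
  case: s {bA bB bC Aa Bb Cc}; lia.
apply: eq_fps_sum => j; rewrite fps_sumMl; last exact: summable_mul bB bC.
rewrite [RHS](fps_sum_reindexD j); apply: eq_fps_sum => i.
by rewrite /F mulrA; congr (_ * C _ _); lia.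
Qed.

Lemma op_mulDl s A B C : bnd s A -> bnd s B -> bnd s C ->
  op_mul (A + B) C = op_mul A C + op_mul B C.
Proof.
move=> bA bB bC; apply: opP => k n.
rewrite -[RHS](fps_sumD (summable_mul k n bA bC) (summable_mul k n bB bC)).
by apply: eq_fps_sum => i; rewrite -mulrDl.
Qed.

Lemma op_mulDr s A B C : bnd s A -> bnd s B -> bnd s C ->
  op_mul A (B + C) = op_mul A B + op_mul A C.
Proof.
move=> bA bB bC; apply: opP => k n.
rewrite -[RHS](fps_sumD (summable_mul k n bA bB) (summable_mul k n bA bC)).
by apply: eq_fps_sum => i; rewrite -mulrDr.
Qed.

Lemma op_mulNl A B : op_mul (- A) B = - op_mul A B.
Proof.
apply: opP => k n; rewrite -[RHS]fps_sumN; apply: eq_fps_sum => i.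
by rewrite -mulNr.
Qed.

Lemma op_mulNr A B : op_mul A (- B) = - op_mul A B.
Proof.
apply: opP => k n; rewrite -[RHS]fps_sumN; apply: eq_fps_sum => i.
by rewrite -mulrN.
Qed.

Lemma op_mul0l A : op_mul 0 A = 0.
Proof.
by apply: opP => k n; apply: fps_sum0 => i; exact: mul0r.
Qed.

Lemma op_mul0r A : op_mul A 0 = 0.
Proof.
by apply: opP => k n; apply: fps_sum0 => i; exact: mulr0.
Qed.

Lemma op_shiftlE c A k n : op_mul (shift_op K c) A k n = A (k - c) (n + c).
Proof.
rewrite /op_mul (@fps_sum_fin _ _ [:: c]) // => [|i].
  by rewrite big_seq1 /shift_op eqxx mul1r.
by rewrite inE /shift_op => /negPf ->; rewrite mul0r.
Qed.

Lemma op_shiftrE c A k n : op_mul A (shift_op K c) k n = A (k - c) n.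
Proof.
rewrite /op_mul (@fps_sum_fin _ _ [:: k - c]) // => [|i].
  by rewrite big_seq1 /shift_op; case: eqP; rewrite ?mulr1 //; lia.
rewrite inE /shift_op; case: eqP => // ik; case: eqP; rewrite ?mulr0 //; lia.
Qed.

Lemma op_mul1 A : op_mul (shift_op K 0) A = A.
Proof. by apply: opP => k n; rewrite op_shiftlE subr0 addr0. Qed.

Lemma op_mulr1 A : op_mul A (shift_op K 0) = A.
Proof. by apply: opP => k n; rewrite op_shiftrE subr0. Qed.

Lemma shift_opD i j : op_mul (shift_op K i) (shift_op K j) = shift_op K (i + j).
Proof.
by apply: opP => k n; rewrite op_shiftlE /shift_op; congr ((_ : bool)%:R); lia.
Qed.

Lemma op_derivD v A B : op_deriv v (A + B) = op_deriv v A + op_deriv v B.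
Proof. by apply: opP => k n; exact: fps_derivD. Qed.

Lemma op_derivN v A : op_deriv v (- A) = - op_deriv v A.
Proof. by apply: opP => k n; exact: fps_derivN. Qed.

Lemma op_derivM s v A B : bnd s A -> bnd s B ->
  op_deriv v (op_mul A B) = op_mul (op_deriv v A) B + op_mul A (op_deriv v B).
Proof.
move=> bA bB; apply: opP => k n.
rewrite -[RHS](fps_sumD (summable_mul k n (bnd_deriv v bA) bB)
  (summable_mul k n bA (bnd_deriv v bB))).
rewrite [LHS](fps_deriv_sum v (summable_mul k n bA bB)).
by apply: eq_fps_sum => i; rewrite fps_derivM.
Qed.

Lemma op_deriv_shift v j : op_deriv v (shift_op K j) = 0.
Proof.
apply: opP => k n; rewrite /op_deriv /shift_op; case: eqP => _; last first.
  exact: fps_deriv0.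
apply: fpsP => m /=; case: eqP => [|_]; last by rewrite mul0rn.
by move/unitm => [_ /(congr1 wt)]; rewrite wt1 wtU; case: v.
Qed.

Lemma op_adjK : involutive (@op_adj K).
Proof.
by move=> A; apply: opP => k n; rewrite /op_adj opprK addrK.
Qed.

(** [op_adj] is transposition of matrices, and the coefficients commute. *)
Lemma op_adjM A B : op_adj (op_mul A B) = op_mul (op_adj B) (op_adj A).
Proof.
apply: opP => k n; rewrite /op_adj /op_mul (fps_sum_reindexD k).
by apply: eq_fps_sum => i; rewrite mulrC; congr (B _ _ * A _ _); lia.
Qed.

Lemma op_adjN A : op_adj (- A) = - op_adj A.
Proof. by []. Qed.

Lemma op_adj_shift j : op_adj (shift_op K j) = shift_op K (- j).
Proof. by apply: opP => k n; rewrite /op_adj /shift_op eqr_oppLR. Qed.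

Lemma op_adj_deriv v A : op_adj (op_deriv v A) = op_deriv v (op_adj A).
Proof. by []. Qed.

End OpTheory.

(** * Series in two sets of times *)

Section TwoTimes.
Variable K : fieldType.
Local Notation tfun := (fps tvar K).
Implicit Types (A B C W V : op K) (s : bool) (f g : tfun) (d : nat).
Implicit Types (m : {cmonom tvar}).

Lemma fps_deriv1 v : fps_deriv v (1 : tfun) = 0.
Proof.
have := congr1 (fun A : op K => A 0 0) (op_deriv_shift K v 0).
by rewrite /op_deriv /shift_op eqxx.
Qed.

Lemma band_adj B : band B -> band (op_adj B).
Proof. by move=> [B1 B2]; split; [exact: (bnd_adj B2)|exact: (bnd_adj B1)]. Qed.

Lemma bandN B : band B -> band (- B).
Proof. by move=> [B1 B2]; split; exact: bndN. Qed.

Lemma band_bnd s B : band B -> bnd s B.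
Proof. by case: s => -[]. Qed.

Lemma op_actD B F G n : band B ->
  op_act B (fun k => F k + G k) n = op_act B F n + op_act B G n.
Proof.
move=> bB; rewrite -fps_sumD; try exact: summable_band.
by apply: eq_fps_sum => i; rewrite mulrDr.
Qed.

Lemma op_actZ B (c : K) F n :
  op_act B (fun k => c *: F k) n = c *: op_act B F n.
Proof.
apply: fpsP => m; rewrite fcoefZ !fcoef_fps_sum mulr_fsumr.
by apply: eq_fsbigr => i _; rewrite mulrC fps_scaleAl mulrC.
Qed.

(** The p-th column of a product is the left factor applied to the p-th column of the right one.
    This turns operator equations into equations for functions of n. *)
Lemma op_mul_act B C p n :
  op_mul B C (p - n) n = op_act B (fun n => C (p - n) n) n.
Proof. by apply: eq_fps_sum => i; congr (_ * C _ _); lia. Qed.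

(** Serves for sums of two operators that are bounded in opposite directions, such as the two halves
    of a cut column. *)
Lemma op_mulDr_band B A C : band B ->
  op_mul B (A + C) = op_mul B A + op_mul B C.
Proof.
move=> bB; apply: opP => k n.
rewrite -[RHS]fps_sumD; try exact: summable_band.
by apply: eq_fps_sum => i; rewrite -mulrDr.
Qed.

(** * Linear evolution equations in characteristic 0 *)

Section CharZero.
Hypothesis charK : [pchar K] =i pred0.

Definition solution (B : tvar -> op K) (F : int -> tfun) :=
  forall v n, fps_deriv v (F n) = op_act (B v) F n.

Lemma mulrSn_eq0 (x : K) n : x *+ n.+1 = 0 -> x = 0.
Proof.
move/eqP; rewrite -mulr_natr mulf_eq0 => /orP[/eqP //|].
by move/pcharf0P: charK => ->.
Qed.

(** Induction on the degree. A positive multiple of the coefficient of [mmul m' (ucm v)] is a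
    coefficient of the derivative at [m'], and the equation expresses it through coefficients of [F]
    of lower degree. Characteristic 0 allows the division by the multiple. *)
Lemma solution_eq0 (B : tvar -> op K) F :
  solution B F -> (forall n, fcoef (F n) mone = 0) ->
  forall n, F n = 0.
Proof.
move=> BF F0 n; apply: fpsP => m; rewrite -[RHS]/0.
have [D] := ubnP (mdeg m); elim: D => // D IH in n m *; rewrite ltnS => mD.
have [m1|[v mv]] : m = mone \/ exists v, m v != 0%N.
- have [->|] := eqVneq m mone; first by left.
  rewrite -mdeg_eq0 mdegE => m0; right; apply: contrapT => nv.
  case/eqP: m0; rewrite big1 // => v _; apply/eqP; apply: contrapT => /negP mv.
  by apply: nv; exists v.
- by rewrite m1.
have [m' mE] := mulcm_ucmP mv; rewrite mE in mD *.
apply: (@mulrSn_eq0 _ (m' v)).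
rewrite -[LHS]/(fcoef (fps_deriv v (F n)) m') BF fcoef_fps_sum fsbig1 // => i _.
rewrite -[_ * _]/(fps_mul _ _) /= fsbig1 // => -[a b].
rewrite /antidiag /= => abm.
rewrite (IH (n + i) b) ?mulr0 //; apply: leq_trans mD.
by rewrite -abm !mdegM mdegU addn1 ltnS leq_addl.
Qed.

Lemma solution_eq (B : tvar -> op K) F G :
  solution B F -> solution B G -> (forall v, band (B v)) ->
  (forall n, fcoef (F n) mone = fcoef (G n) mone) -> forall n, F n = G n.
Proof.
move=> BF BG bB FG n; apply/eqP; rewrite -subr_eq0; apply/eqP.
apply: (@solution_eq0 B (fun n => F n - G n)) => [v k|k].
  rewrite fps_derivD fps_derivN BF BG.
  rewrite (_ : (fun k => _) = (fun k => F k + (-1) *: G k)); last first.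
    by apply/funext => j; rewrite scaleN1r.
  by rewrite op_actD // op_actZ scaleN1r.
by rewrite fcoefB FG subrr.
Qed.

Lemma fps_const_eq0 f :
  (forall v, fps_deriv v f = 0) -> fcoef f mone = 0 -> f = 0.
Proof.
move=> df f0; apply: (@solution_eq0 (fun=> 0) (fun=> f) _ _ 0) => // v n.
by rewrite df; apply/esym/fps_sum0 => i; exact: mul0r.
Qed.

Lemma solutionD (B : tvar -> op K) F G : (forall v, band (B v)) ->
  solution B F -> solution B G -> solution B (fun n => F n + G n).
Proof. by move=> bB BF BG v n; rewrite fps_derivD BF BG op_actD. Qed.

Lemma solution_sum (B : tvar -> op K) (J : Type) (r : seq J) (c : J -> K)
    (q : J -> int -> tfun) :
  (forall v, band (B v)) -> (forall l, solution B (q l)) ->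
  solution B (fun n => \sum_(l <- r) c l *: q l n).
Proof.
move=> bB Bq; elim: r => [|l r IH].
  move=> v n; rewrite big_nil fps_deriv0; apply/esym/fps_sum0 => i.
  by rewrite big_nil mulr0.
rewrite (_ : (fun n => _) =
  (fun n => c l *: q l n + \sum_(l <- r) c l *: q l n)); last first.
  by apply/funext => n; rewrite big_cons.
by apply: solutionD => // v n; rewrite fps_derivZ Bq op_actZ.
Qed.

Lemma solution_mul s (B : tvar -> op K) W C p :
  (forall v, bnd s (B v)) -> bnd s W -> bnd s C ->
  (forall v, op_deriv v W = op_mul (B v) W) -> (forall v, op_deriv v C = 0) ->
  solution B (fun n => op_mul W C (p - n) n).
Proof.
move=> bB bW bC dW dC v n; rewrite -op_mul_act.
rewrite -[LHS]/(op_deriv v (op_mul W C) (p - n) n) (op_derivM v bW bC) dW dC.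
by rewrite op_mul0r addr0 (@op_mulA _ s).
Qed.

(** Freezes one of the two sets of times at a coefficient. The result is constant in the remaining
    times, so a product in two sets of times becomes an ordinary operator product. *)
Definition slice m A : op K := fun k n => fcoef (A k n) m *: (1 : tfun).

Lemma bnd_slice s m A : bnd s A -> bnd s (slice m A).
Proof.
move=> bA d; have [a Aa] := bA (wt m); exists a => k n ka.
by rewrite /slice Aa // scale0r.
Qed.

Lemma op_deriv_slice v m A : op_deriv v (slice m A) = 0.
Proof.
by apply: opP => k n; rewrite /op_deriv /slice fps_derivZ fps_deriv1 scaler0.
Qed.

(* The coefficient of t'^m t''^m' in the (n, p) entry of the product of the
   matrices [A(t')] and [B(t'')], where [A n p] stands for the coefficient of
   Lambda^(p - n) at n. *)
Definition pair A B m m' (n p : int) : K :=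
  \sum_(i \in [set: int]) fcoef (A (i - n) n) m * fcoef (B (p - i) i) m'.

(** Transposition exchanges t' and t'', so a result on the evolution in t' also covers t''. *)
Lemma pair_adj A B m m' n p :
  pair A B m m' n p = pair (op_adj B) (op_adj A) m' m p n.
Proof.
apply: eq_fsbigr => i _; rewrite /op_adj mulrC.
by congr (fcoef (B _ _) _ * fcoef (A _ _) _); lia.
Qed.

Lemma pairEr A B m m' n p :
  pair A B m m' n p = fcoef (op_mul A (slice m' B) (p - n) n) m.
Proof.
rewrite /pair (@reindex_fsbigT _ _ _ _ _ (fun i => n + i)); last first.
  by exists (fun i => i - n) => i; rewrite [n + _]addrC ?addrK ?subrK.
rewrite fcoef_fps_sum; apply: eq_fsbigr => i _.
rewrite /slice [A _ _ * _]mulrC fps_scaleAl fcoefZ mul1r mulrC.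
by congr (fcoef (B _ _) _ * fcoef (A _ _) _); lia.
Qed.

Lemma pairEl A B m m' n p :
  pair A B m m' n p = fcoef (op_mul (slice m A) B (p - n) n) m'.
Proof.
rewrite /pair (@reindex_fsbigT _ _ _ _ _ (fun i => n + i)); last first.
  by exists (fun i => i - n) => i; rewrite [n + _]addrC ?addrK ?subrK.
rewrite fcoef_fps_sum; apply: eq_fsbigr => i _.
rewrite /slice fps_scaleAl fcoefZ mul1r.
by congr (fcoef (A _ _) _ * fcoef (B _ _) _); lia.
Qed.

Lemma pair11 A B n p :
  pair A B mone mone n p = fcoef (op_mul A B (p - n) n) mone.
Proof.
rewrite /pair (@reindex_fsbigT _ _ _ _ _ (fun i => n + i)); last first.
  by exists (fun i => i - n) => i; rewrite [n + _]addrC ?addrK ?subrK.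
rewrite fcoef_fps_sum; apply: eq_fsbigr => i _; rewrite fcoefM1.
by congr (fcoef (A _ _) _ * fcoef (B _ _) _); lia.
Qed.

Lemma pairNr A B m m' n p : pair A (- B) m m' n p = - pair A B m m' n p.
Proof.
rewrite /pair -[RHS]mulN1r mulr_fsumr; apply: eq_fsbigr => i _.
by rewrite mulN1r -mulrN.
Qed.

Definition op_eq1 A B := forall k n, fcoef (A k n) mone = fcoef (B k n) mone.

Lemma op_eq1M A A' B B' :
  op_eq1 A A' -> op_eq1 B B' -> op_eq1 (op_mul A B) (op_mul A' B').
Proof.
move=> AA BB k n; rewrite fcoef_fps_sum; apply: eq_fsbigr => i _.
by rewrite !fcoefM1 AA BB.
Qed.

(** With t'' frozen at [m'] and the column [p] fixed, both sides are solutions in t' of the same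
    equation, and they agree at t' = 0. *)
Lemma pair_ext (B : tvar -> op K) s1 s2 W1 V1 W2 V2 N (c : 'I_N -> K)
    (q : 'I_N -> int -> tfun) m' p :
  (forall v, band (B v)) ->
  bnd s1 W1 -> bnd s1 V1 -> bnd s2 W2 -> bnd s2 V2 ->
  (forall v, op_deriv v W1 = op_mul (B v) W1) ->
  (forall v, op_deriv v W2 = op_mul (B v) W2) ->
  (forall l, solution B (q l)) ->
  (forall n, pair W1 V1 mone m' n p =
     pair W2 V2 mone m' n p + \sum_l c l * fcoef (q l n) mone) ->
  forall m n, pair W1 V1 m m' n p =
     pair W2 V2 m m' n p + \sum_l c l * fcoef (q l n) m.
Proof.
move=> bB bW1 bV1 bW2 bV2 dW1 dW2 Bq init.
pose F1 n := op_mul W1 (slice m' V1) (p - n) n.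
pose F2 n := op_mul W2 (slice m' V2) (p - n) n + \sum_l c l *: q l n.
have F1sol : solution B F1.
  apply: (solution_mul p (fun v => band_bnd s1 (bB v)) bW1
    (bnd_slice m' bV1)) => // v.
  exact: op_deriv_slice.
have F2sol : solution B F2.
  apply: solutionD => //; last exact: solution_sum.
  apply: (solution_mul p (fun v => band_bnd s2 (bB v)) bW2
    (bnd_slice m' bV2)) => // v.
  exact: op_deriv_slice.
have FE m n : fcoef (F2 n) m =
    pair W2 V2 m m' n p + \sum_l c l * fcoef (q l n) m.
  by rewrite fcoefD fcoef_sum pairEr.
move=> m n; rewrite -FE pairEr -/(F1 n); congr fcoef.
by apply: (solution_eq F1sol F2sol) => // k; rewrite FE -init pairEr.
Qed.

(** [pair_ext] is used twice: on the transposed matrices it carries the identity from t' = t'' = 0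
    to all t'', and on the original ones from t' = 0 to all t'. *)
Lemma bilinear_identity (B : tvar -> op K) s1 s2 W1 V1 W2 V2 N
    (q r : 'I_N -> int -> tfun) :
  (forall v, band (B v)) ->
  bnd s1 W1 -> bnd s1 V1 -> bnd s2 W2 -> bnd s2 V2 ->
  (forall v, op_deriv v W1 = op_mul (B v) W1) ->
  (forall v, op_deriv v W2 = op_mul (B v) W2) ->
  (forall v, op_deriv v V1 = - op_mul V1 (B v)) ->
  (forall v, op_deriv v V2 = - op_mul V2 (B v)) ->
  (forall l, solution B (q l)) ->
  (forall l, solution (fun v => - op_adj (B v)) (r l)) ->
  (forall n p, pair W1 V1 mone mone n p = pair W2 V2 mone mone n p +
     \sum_l fcoef (q l n) mone * fcoef (r l p) mone) ->
  forall m m' n p, pair W1 V1 m m' n p = pair W2 V2 m m' n p +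
     \sum_l fcoef (q l n) m * fcoef (r l p) m'.
Proof.
move=> bB bW1 bV1 bW2 bV2 dW1 dW2 dV1 dV2 Bq Br init m m' n p.
under eq_bigr do rewrite mulrC.
apply: (pair_ext bB bW1 bV1 bW2 bV2 dW1 dW2 Bq) => {m}n.
under eq_bigr do rewrite mulrC.
rewrite !(pair_adj _ _ mone).
have dadj V : (forall v, op_deriv v V = - op_mul V (B v)) ->
    forall v, op_deriv v (op_adj V) = op_mul (- op_adj (B v)) (op_adj V).
  by move=> dV v; rewrite -op_adj_deriv dV op_adjN op_adjM op_mulNl.
apply: (@pair_ext (fun v => - op_adj (B v)) (~~ s1) (~~ s2)) => //.
- by move=> v; apply/bandN/band_adj.
- exact: bnd_adj.
- exact: bnd_adj.
- exact: bnd_adj.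
- exact: bnd_adj.
- exact: dadj.
- exact: dadj.
- by move=> k; rewrite -!(pair_adj _ _ mone) init.
Qed.

(* The matrix whose only nonzero column, the p-th one, is q restricted to P. *)
Definition colop (P : pred int) (q : int -> tfun) (p : int) : op K :=
  fun k n => if (n + k == p) && P n then q n else 0.

(** The products with index 1 and 2 are bounded in opposite directions, so neither applies to the
    whole column [q]; each receives the half on which its sum converges. The whole column satisfies
    the equation of [q], hence the halves violate it by opposite amounts, and the Toda identity
    makes these cancel. *)
Lemma propagator_column (B : tvar -> op K) W1 V1 W2 V2 (q : int -> tfun) :
  (forall v, band (B v)) ->
  bnd true W1 -> bnd true V1 -> bnd false W2 -> bnd false V2 ->
  (forall v, op_deriv v W1 = op_mul (B v) W1) ->
  (forall v, op_deriv v W2 = op_mul (B v) W2) ->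
  (forall v, op_deriv v V1 = - op_mul V1 (B v)) ->
  (forall v, op_deriv v V2 = - op_mul V2 (B v)) ->
  op_eq1 (op_mul W1 V1) (shift_op K 0) ->
  op_eq1 (op_mul W2 V2) (shift_op K 0) ->
  solution B q ->
  forall m m' n p,
    pair W1 (op_mul V1 (colop (>= p) q p)) m m' n p +
    pair W2 (op_mul V2 (colop (< p) q p)) m m' n p =
    fcoef (q n) m * fcoef (1 : tfun) m'.
Proof.
move=> bB bW1 bV1 bW2 bV2 dW1 dW2 dV1 dV2 WV1 WV2 Bq m m' n p.
set Q1 := colop _ _ _; set Q2 := colop (< p) _ _.
have bQ1 : bnd true Q1.
  move=> d; exists 0%N => k j /= k0; rewrite /Q1 /colop.
  by case: ifP => // /andP[/eqP <-] /=; move: k0; rewrite /dir; lia.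
have bQ2 : bnd false Q2.
  move=> d; exists 0%N => k j /= k0; rewrite /Q2 /colop.
  by case: ifP => // /andP[/eqP <-] /=; move: k0; rewrite /dir; lia.
have QE k j : (Q1 + Q2) k j = if j + k == p then q j else 0.
  rewrite -[LHS]/(Q1 k j + Q2 k j) /Q1 /Q2 /colop.
  by case: eqP => _ /=; [have [] := leP p j|]; rewrite ?addr0 ?add0r.
have dQ v : op_deriv v (Q1 + Q2) = op_mul (B v) (Q1 + Q2).
  apply: opP => k j; rewrite /op_deriv QE.
  have -> : op_mul (B v) (Q1 + Q2) k j =
      fps_sum (fun i => B v i j * (if j + k == p then q (j + i) else 0)).
    apply: eq_fps_sum => i; rewrite QE.
    by rewrite addrA addrAC addrK.
  case: eqP => _; first exact: Bq.
  by rewrite fps_deriv0; apply/esym/fps_sum0 => i; rewrite mulr0.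
(* The amount by which the upper half of the column fails to solve the equation, because [B v] does
   not commute with the cut at [p]. *)
pose R v := op_deriv v Q1 - op_mul (B v) Q1.
have RE v : op_deriv v Q2 - op_mul (B v) Q2 = - R v.
  have := dQ v; rewrite op_derivD op_mulDr_band // => /eqP.
  by rewrite -subr_eq0 opprD addrACA addrC addr_eq0 => /eqP ->.
have bR1 v : bnd true (R v).
  by apply: bndB; [exact: bnd_deriv|apply: bndM => //; exact: band_bnd].
have bR2 v : bnd false (R v).
  rewrite -[R v]opprK -RE; apply: bndN.
  by apply: bndB; [exact: bnd_deriv|apply: bndM => //; exact: band_bnd].
have dVQ s V Q v : bnd s V -> bnd s Q -> op_deriv v V = - op_mul V (B v) ->
    op_deriv v (op_mul V Q) = op_mul V (op_deriv v Q - op_mul (B v) Q).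
  move=> bV bQ dV; have bBs := band_bnd s (bB v).
  rewrite (op_derivM v bV bQ) dV op_mulNl (@op_mulA _ s) // addrC -op_mulNr.
  by rewrite -(op_mulDr bV (bnd_deriv v bQ)) //; apply/bndN/bndM.
(* The Toda identity is the bilinear identity with an empty family of sources: both products are the
   identity at t' = t'' = 0. *)
have toda a a' j k : pair W1 V1 a a' j k = pair W2 V2 a a' j k.
  have q0 (l : 'I_0) : int -> tfun by case: l.
  have := @bilinear_identity B true false W1 V1 W2 V2 0 q0 q0 bB.
  move=> /(_ bW1 bV1 bW2 bV2 dW1 dW2 dV1 dV2) -> //.
  - by rewrite big_ord0 addr0.
  - by case.
  - by case.
  by move=> x y; rewrite big_ord0 addr0 !pair11 WV1 WV2.
have toda_op a : op_mul (slice a W1) V1 = op_mul (slice a W2) V2.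
  apply: opP => k j; apply: fpsP => b.
  by have := toda a b j (j + k); rewrite !pairEl addrC addKr.
(* [R] is banded since it comes from both halves of the column, so that it can be
   moved across the Toda identity. *)
have step : pair W1 (op_mul V1 Q1) m mone n p =
    pair W2 (- op_mul V2 Q2) m mone n p + \sum_(l < 1) 1 * fcoef (q n) m.
  apply: (@pair_ext B true false W1 _ W2 _ 1 (fun=> 1) (fun=> q)) => //.
  - exact: bndM.
  - exact/bndN/bndM.
  move=> j; rewrite big_ord1 mul1r pairNr !pair11.
  rewrite -(op_mulA bW1 bV1 bQ1) -(op_mulA bW2 bV2 bQ2).
  rewrite (@op_eq1M _ _ Q1 Q1 WV1) // (@op_eq1M _ _ Q2 Q2 WV2) // !op_mul1.
  apply/eqP; rewrite [- _ + _]addrC -subr_eq opprK -fcoefD.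
  by rewrite -[_ + _]/((Q1 + Q2) _ _) QE addrC subrK !eqxx.
(* The defect of the claim as a series in t'', at a frozen coefficient of t'. Its constant term
   vanishes by [step], and its derivatives are the difference of the two Toda products multiplied by
   [R v]. *)
pose F := op_mul (slice m W1) (op_mul V1 Q1) (p - n) n +
          op_mul (slice m W2) (op_mul V2 Q2) (p - n) n -
          fcoef (q n) m *: (1 : tfun).
suff /(congr1 (fun f => fcoef f m')) : F = 0.
  rewrite /F fcoefB fcoefD -!pairEl => /eqP.
  by rewrite subr_eq0 => /eqP ->.
apply: fps_const_eq0 => [v|]; last first.
  rewrite /F fcoefB fcoefD -!pairEl step big_ord1 mul1r pairNr.
  rewrite -[fcoef (_ *: _) _]/(_ * fcoef (1 : tfun) mone).
  by rewrite [- _ + _]addrC subrK /= eqxx mulr1 subrr.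
have dD s A V Q : bnd s A -> bnd s V -> bnd s Q ->
    op_deriv v V = - op_mul V (B v) ->
    bnd s (op_deriv v Q - op_mul (B v) Q) ->
    op_deriv v (op_mul (slice m A) (op_mul V Q)) =
    op_mul (op_mul (slice m A) V) (op_deriv v Q - op_mul (B v) Q).
  move=> bA bV bQ dV bR; have bAs := bnd_slice m bA.
  rewrite (op_derivM v bAs (bndM bV bQ)) op_deriv_slice op_mul0l add0r.
  by rewrite (dVQ s) // (op_mulA bAs).
rewrite /F 2!fps_derivD fps_derivN fps_derivZ fps_deriv1 scaler0 subr0.
rewrite -[X in X + _]/(op_deriv v _ _ _) -[X in _ + X]/(op_deriv v _ _ _).
rewrite (dD true) //; last exact: (bR1 v).
rewrite (dD false) //; last by rewrite RE; exact: bndN.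
by rewrite RE op_mulNr -/(R v) toda_op; exact: subrr.
Qed.

End CharZero.
End TwoTimes.

(** * Exponentials and inverses of operators *)

Section Wave.
Variable K : fieldType.
Local Notation tfun := (fps tvar K).
Implicit Types (A B C S T W V X : op K) (s : bool) (f g : tfun) (d : nat).
Implicit Types (m : {cmonom tvar}).

Lemma fps_sum_natS (F : nat -> tfun) :
  F 0%N = 0 -> fps_sum F = fps_sum (fun l => F l.+1).
Proof.
move=> F0; apply: fpsP => m; rewrite !fcoef_fps_sum.
rewrite -(@fsbig_widen _ _ _ _ [set l | (0 < l)%N]%classic) //; last first.
  by case=> [_|l [_ /(_ isT)]] //=; rewrite F0.
apply: (@reindex_fsbig _ _ _ _ _ succn); split=> [l _|l l' _ _ []|l] //=.
by case: l => // l _; exists l.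
Qed.

Lemma fps_sum_int_ge (p : int) (F : int -> tfun) :
  fps_sum (fun x : int => if p <= x then F x else 0) =
  fps_sum (fun l : nat => F (p + l%:Z)).
Proof.
apply: fpsP => m; rewrite !fcoef_fps_sum.
rewrite -(@fsbig_widen _ _ _ _ [set x | p <= x]%classic) //; last first.
  by move=> x [_ /negP /negPf /= ->].
rewrite (@reindex_fsbig _ _ _ nat _ (fun l : nat => p + l%:Z) setT); last first.
  split=> [l _|l l' _ _ /addrI []|x /=] //=; first by rewrite lerDl.
  by move=> px; exists (absz (x - p)) => //; lia.
by apply: eq_fsbigr => l _; rewrite lerDl.
Qed.

Lemma fps_sum_int_lt (p : int) (F : int -> tfun) :
  fps_sum (fun x : int => if x < p then F x else 0) =
  fps_sum (fun l : nat => F (p - l.+1%:Z)).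
Proof.
apply: fpsP => m; rewrite !fcoef_fps_sum.
rewrite -(@fsbig_widen _ _ _ _ [set x | x < p]%classic) //; last first.
  by move=> x [_ /negP /negPf /= ->].
rewrite (@reindex_fsbig _ _ _ nat _ (fun l => p - l.+1%:Z) setT); last first.
  split=> [l _|l l' _ _ /addrI /oppr_inj []|x /=] //=; first by lia.
  by move=> px; exists (absz (p - x)).-1 => //; lia.
by apply: eq_fsbigr => l _; rewrite ifT //; lia.
Qed.

Lemma op_mulMn s A B l : bnd s A -> bnd s B ->
  op_mul A (B *+ l) = op_mul A B *+ l.
Proof.
move=> bA bB; elim: l => [|l IH]; first by rewrite !mulr0n op_mul0r.
rewrite !mulrS (op_mulDr bA bB) ?IH //.
by elim: l {IH} => [|l IH]; rewrite ?mulr0n ?mulrS; [exact: bnd0|exact: bndD].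
Qed.

Lemma opMnE A l k n : (A *+ l) k n = A k n *+ l.
Proof. by elim: l => // l IH; rewrite !mulrS -IH. Qed.

(** * The exponential of an operator without constant term *)

Section Exp.
Hypothesis charK : [pchar K] =i pred0.
Variables (s : bool) (A : op K) (X : tvar -> op K).
Hypothesis nilA : forall k n m,
  (wt m = 0%N) \/ ((wt m)%:Z < dir s k) -> fcoef (A k n) m = 0.
Hypothesis bX : forall v, band (X v).
Hypothesis dA : forall v, op_deriv v A = X v.
Hypothesis AX : forall v, op_mul A (X v) = op_mul (X v) A.

(** Every factor [A] contributes weight at least 1, and at least as much weight as its order in the
    direction [s]; both bounds add up under products. *)
Lemma op_pow_nil l k n m :
  (wt m < l)%N \/ ((wt m)%:Z < dir s k) -> fcoef (op_pow A l k n) m = 0.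
Proof.
elim: l => [|l IH] in k n m *.
  case=> //; rewrite /op_pow /shift_op /=.
  by case: eqP => [->|//]; rewrite /dir; case: s; lia.
move=> H; rewrite [op_pow _ _]/(op_mul A (op_pow A l)).
rewrite fcoef_fps_sum fsbig1 // => i _.
rewrite -[_ * _]/(fps_mul _ _) /= fsbig1 // => -[a b].
rewrite /antidiag /= => abm.
have abw : wt m = (wt a + wt b)%N by rewrite -wtM abm.
have [a0|a0] := eqVneq (wt a) 0%N; first by rewrite nilA ?mul0r; auto.
have [ai|ai] := ltP (wt a)%:Z (dir s i); first by rewrite nilA ?mul0r; auto.
rewrite IH ?mulr0 //; case: H => H; [left; lia|right].
by move: ai H; rewrite /dir; case: s; lia.
Qed.

Lemma bnd_pow_nil l : bnd s (op_pow A l).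
Proof.
by move=> d; exists d => k n dk m md; rewrite op_pow_nil //; right; lia.
Qed.

Lemma bnd_nil : bnd s A.
Proof. by move=> d; exists d => k n dk m md; rewrite nilA //; right; lia. Qed.

Lemma bnd_exp : bnd s (op_exp A).
Proof.
move=> d; exists d => k n dk m md; rewrite fcoef_fps_sum fsbig1 // => l _.
by rewrite fcoefZ op_pow_nil ?mulr0 //; right; lia.
Qed.

Lemma summable_exp k n :
  summable (fun l : nat => (l`!%:R)^-1 *: op_pow A l k n).
Proof.
move=> d; exists (iota 0 d.+1); first exact: iota_uniq.
move=> l; rewrite mem_iota => ld m md.
by rewrite fcoefZ op_pow_nil ?mulr0 //; left; lia.
Qed.

Lemma op_eq1_exp : op_eq1 (op_exp A) (shift_op K 0).
Proof.
move=> k n; rewrite fcoef_fps_sum (@fsbigE _ _ _ _ _ [:: 0%N]) // => [|l _].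
  by rewrite big_mkcond big_seq1 mem_set //= fact0 invr1 mul1r.
rewrite inE => l0; rewrite fcoefZ op_pow_nil ?mulr0 //; left.
by rewrite wt1; lia.
Qed.

Lemma op_deriv_pow v l :
  op_deriv v (op_pow A l.+1) = op_mul (X v) (op_pow A l) *+ l.+1.
Proof.
have bXs := band_bnd s (bX v).
elim: l => [|l IH].
  by rewrite mulr1n /op_pow /= !op_mulr1.
rewrite [op_pow A l.+2]/(op_mul A (op_pow A l.+1)).
rewrite (op_derivM v bnd_nil (bnd_pow_nil _)) dA IH.
rewrite (op_mulMn _ bnd_nil); last by apply: bndM => //; exact: bnd_pow_nil.
rewrite -(op_mulA bnd_nil bXs (bnd_pow_nil l)) AX.
by rewrite (op_mulA bXs bnd_nil (bnd_pow_nil l)) -mulrS.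
Qed.

(** As [X v] commutes with [A], the derivative of the term of index [l.+1] is [X v] times the term
    of index [l]. Characteristic 0 is used to cancel [l.+1] against the factorial. *)
Lemma op_deriv_exp v : op_deriv v (op_exp A) = op_mul (X v) (op_exp A).
Proof.
apply: opP => k n; rewrite [LHS](fps_deriv_sum v (summable_exp k n)).
rewrite fps_sum_natS; last first.
  rewrite fps_derivZ -[fps_deriv _ _]/(op_deriv v (shift_op K 0) k n).
  by rewrite op_deriv_shift; exact: scaler0.
transitivity (fps_sum (fun l : nat => fps_sum (fun i : int =>
    X v i n * ((l`!%:R)^-1 *: op_pow A l (k - i) (n + i))))).
  apply: eq_fps_sum => l; rewrite fps_derivZ.
  rewrite -[fps_deriv _ _]/(op_deriv v (op_pow A l.+1) k n) op_deriv_pow opMnE.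
  rewrite -scaler_nat scalerA factS natrM invfM mulrAC mulVf ?mul1r; last first.
    by move/pcharf0P: charK => ->.
  apply: fpsP => m; rewrite fcoefZ !fcoef_fps_sum mulr_fsumr.
  apply: eq_fsbigr => i _.
  by rewrite -fcoefZ [X v i n * op_pow _ _ _ _]mulrC -fps_scaleAl mulrC.
rewrite fps_sum_exchange => [|d].
  apply: eq_fps_sum => i; rewrite fps_sumMl //; exact: summable_exp.
have [r ru Xr] := summable_band n (fun=> 1) (bX v) d.
exists (iota 0 d.+1), r; split; rewrite ?iota_uniq // => l i.
rewrite mem_iota => /orP[ld|ir]; last first.
  by apply: eqmodM0; have := Xr _ ir; rewrite mulr1.
apply: eqmodM0r => m md; rewrite fcoefZ op_pow_nil ?mulr0 //; left; lia.
Qed.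

End Exp.

(** [op_inv] takes the default value 0 when the class contains no inverse, so a nonzero value is
    itself evidence of an inverse. *)
Lemma op_invP D S : op_inv D S != 0 \/ (exists T,
    [/\ D T, op_mul S T = shift_op K 0 & op_mul T S = shift_op K 0]) ->
  [/\ D (op_inv D S), op_mul S (op_inv D S) = shift_op K 0 &
     op_mul (op_inv D S) S = shift_op K 0].
Proof.
rewrite /op_inv; case: xgetP => [_ _ //|none []]; first by rewrite eqxx.
by case=> T; move/none.
Qed.

(** * Inversion of series in nonnegative powers of Lambda *)

Section UpperInverse.
Variable S : op K.
Hypothesis S_upper : op_upper S.
Hypothesis S_lead : forall n, S 0 n \is a GRing.unit.

(** The coefficient of Lambda^k in the equation S T = 1, solved for T_k in terms of the coefficients
    of lower index. *)
Let step (F : nat -> int -> tfun) (k : nat) (n : int) : tfun :=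
  (S 0 n)^-1 * ((k == 0%N)%:R -
     \sum_(i < k) S i.+1%:Z n * F (k - i.+1)%N (n + i.+1%:Z)).

(** Course-of-values recursion by iteration: the value at [k] reads only values below [k], so it is
    settled after [k.+1] rounds. *)
Let coef (k : nat) (n : int) : tfun := iter k.+1 step (fun _ _ => 0) k n.

Let iter_step k l l' n : (k < l)%N -> (k < l')%N ->
  iter l step (fun _ _ => 0) k n = iter l' step (fun _ _ => 0) k n.
Proof.
elim/ltn_ind: k => k IH in l l' n *; case: l => // l; case: l' => // l' kl kl'.
rewrite !iterS /step; congr (_ * (_ - _)); apply: eq_bigr => i _; congr (_ * _).
by have := ltn_ord i => ik; apply: IH; lia.
Qed.

Let coefE k n : coef k n = step coef k n.
Proof.
rewrite /coef iterS /step; congr (_ * (_ - _)); apply: eq_bigr => i _.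
by have := ltn_ord i => ik; congr (_ * _); apply: iter_step; lia.
Qed.

Lemma upper_right_inverse : exists T,
  [/\ op_upper T, op_mul S T = shift_op K 0 & forall n, T 0 n \is a GRing.unit].
Proof.
exists (fun k n => if k is Posz j then coef j n else 0); split.
- by case.
- apply: opP => -[k|k] n; last first.
    rewrite /op_mul fps_sum0 // => i; have [i0|i0] := ltP i 0.
      by rewrite S_upper // mul0r.
    by case E : (Negz k - i) => [j|j]; rewrite ?mulr0 //; lia.
  rewrite /op_mul (@fps_sum_fin _ _ [seq Posz i | i <- iota 0 k.+1]).
  + rewrite big_map -[iota 0 k.+1]/(index_iota 0 k.+1)
      big_mkord big_ord_recl /=.
    rewrite addn0 (_ : n + 0%:Z = n) ?addr0 // -[S 0%Z n]/(S 0 n).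
    rewrite coefE /step mulrA mulrV // mul1r.
    rewrite [X in _ + X](_ : _ =
      \sum_(i < k) S i.+1%:Z n * coef (k - i.+1)%N (n + i.+1%:Z)); last first.
      apply: eq_bigr => i _; rewrite /bump /= add1n.
      by rewrite subzn // ltn_ord.
    by rewrite subrK.
  + by rewrite map_inj_uniq ?iota_uniq // => i j [].
  + move=> i ik; have [i0|i0] := ltP i 0; first by rewrite S_upper // mul0r.
    case E : (Posz k - i) => [j|j]; rewrite ?mulr0 //.
    case/mapP: ik; exists (absz i); last by lia.
    by rewrite mem_iota; lia.
- move=> n; rewrite -[X in X \is a _]/(coef 0%N n) coefE /step big_ord0.
  rewrite subr0 mulr1 unitrV; exact: S_lead.
Qed.

End UpperInverse.

Lemma op_upper_bnd A : op_upper A -> bnd false A.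
Proof. by move=> uA d; exists 0%N => k n /= k0; rewrite uA //; lia. Qed.

Lemma op_lower_bnd A : op_lower A -> bnd true A.
Proof. by move=> lA d; exists 0%N => k n /= k0; rewrite lA //; lia. Qed.

(** The right inverse T has an invertible leading coefficient, hence a right inverse S' of its own,
    and S = S T S' = S'. *)
Lemma op_upper_inverse S : op_upper S -> (forall n, S 0 n \is a GRing.unit) ->
  exists T, [/\ op_upper T, op_mul S T = shift_op K 0 &
    op_mul T S = shift_op K 0].
Proof.
move=> uS lS; have [T [uT ST lT]] := upper_right_inverse uS lS.
have [S' [uS' TS' _]] := upper_right_inverse uT lT.
suff SS : S = S' by exists T; split=> //; rewrite SS.
have [[bS bT] bS'] := (op_upper_bnd uS, op_upper_bnd uT, op_upper_bnd uS').
have := op_mulA bS bT bS'; rewrite ST TS' op_mul1 op_mulr1; exact: esym.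
Qed.

End Wave.

(** * Wave operators *)

Section Dressing.
Variable K : fieldType.
Local Notation tfun := (fps tvar K).
Implicit Types (A S T V : op K) (s : bool) (f g : tfun) (d : nat).
Implicit Types (m : {cmonom tvar}).

Lemma fps_deriv_var (u v : tvar) :
  fps_deriv v (fps_var u : tfun) = (v == u)%:R.
Proof.
apply: fpsP => m; rewrite -[LHS]/((mmul m (ucm v) == ucm u)%:R *+ (m v).+1).
have [<-|vu] := eqVneq v u.
  rewrite mulr1n -[RHS]/((m == mone)%:R).
  have -> : (mmul m (ucm v) == ucm v) = (m == mone).
    by rewrite -{2}[ucm v]mul1m (inj_eq (@mulcmIr v)).
  by case: eqP => [->|_]; rewrite ?cm1 ?mul0rn.
rewrite -[RHS]/0; case: eqP => [/(congr1 (fun m : {cmonom tvar} => m v))|_].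
  by rewrite cmM cmUU cmU eq_sym (negPf vu) addn1.
exact: mul0rn.
Qed.

Section Time.
Variable tv : nat -> tvar.
Hypothesis tv_inj : injective tv.
Hypothesis tvw : forall j, vwt (tv j) = j.+1.

Definition xi_deriv (v : tvar) : op K :=
  fun k _ => if k is Posz j.+1 then (v == tv j)%:R else 0.

Lemma xi_derivE v : op_deriv v (xi_op K tv) = xi_deriv v.
Proof.
by apply: opP => -[[|j]|j] n; rewrite /op_deriv /= ?fps_deriv0 ?fps_deriv_var.
Qed.

Lemma xi_deriv_tv p : xi_deriv (tv p) = shift_op K p.+1%:Z.
Proof.
apply: opP => -[[|j]|j] n //=; rewrite /shift_op (inj_eq tv_inj) eq_sym.
by congr ((_ : bool)%:R); lia.
Qed.

Lemma xi_deriv0 v : (forall p, v != tv p) -> xi_deriv v = 0.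
Proof. by move=> vN; apply: opP => -[[|j]|j] n //=; rewrite (negPf (vN j)). Qed.

Lemma xi_deriv_case v : (exists j, xi_deriv v = shift_op K j) \/ xi_deriv v = 0.
Proof.
have [[p ->]|vN] := pselect (exists p, v = tv p).
  by left; exists p.+1%:Z; exact: xi_deriv_tv.
right; apply: xi_deriv0 => p; apply/eqP => vp; apply: vN; by exists p.
Qed.

Lemma xi_nil k n m :
  (wt m = 0%N) \/ ((wt m)%:Z < dir true k) -> fcoef (xi_op K tv k n) m = 0.
Proof.
case: k => [[|j]|j] //= H; rewrite /fps_var /=; case: eqP => // mE.
by move: H; rewrite mE wtU tvw; lia.
Qed.

End Time.

(* [A] stands for the exponents [xi(t, Lambda)], their adjoints and opposites. *)
Record phase s (A : op K) (X : tvar -> op K) : Prop := Phase {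
  phase_nil : forall k n m,
    (wt m = 0%N) \/ ((wt m)%:Z < dir s k) -> fcoef (A k n) m = 0;
  phase_band : forall v, band (X v);
  phase_deriv : forall v, op_deriv v A = X v;
  phase_comm : forall v, op_mul A (X v) = op_mul (X v) A }.

Lemma phase_xi tv : injective tv -> (forall j, vwt (tv j) = j.+1) ->
  phase true (xi_op K tv) (xi_deriv tv).
Proof.
move=> tvI tvw; split=> [k n m|v|v|v].
- exact: xi_nil.
- case: (xi_deriv_case tvI v) => [[j ->]|->].
    by split; exact: bnd_shift.
  by split; exact: bnd0.
- exact: xi_derivE.
- case: (xi_deriv_case tvI v) => [[j ->]|->].
    by apply: opP => k n; rewrite op_shiftlE op_shiftrE.
  by rewrite op_mul0l op_mul0r.
Qed.

Lemma phase_adj s A X :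
  phase s A X -> phase (~~ s) (op_adj A) (fun v => op_adj (X v)).
Proof.
move=> [nilA bX dA cA]; split=> [k n m H|v|v|v].
- apply: nilA; case: H => H; [by left|right].
  by move: H; rewrite /dir; case: s; rewrite ?opprK.
- exact: band_adj.
- by rewrite -op_adj_deriv dA.
- by rewrite -!op_adjM cA.
Qed.

Lemma phaseN s A X : phase s A X -> phase s (- A) (fun v => - X v).
Proof.
move=> [nilA bX dA cA]; split=> [k n m H|v|v|v].
- by rewrite -[LHS]/(- fcoef (A k n) m) nilA ?oppr0.
- exact: bandN.
- by rewrite op_derivN dA.
- by rewrite !op_mulNl !op_mulNr cA.
Qed.

(** * The wave matrix of a dressing operator and its inverse *)

Section WavePair.
Hypothesis charK : [pchar K] =i pred0.
Variables (s : bool) (A S T : op K) (X B : tvar -> op K).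
Hypothesis pA : phase s A X.
Hypothesis bB : forall v, band (B v).
Hypotheses (bS : bnd s S) (bT : bnd s T).
Hypotheses (ST : op_mul S T = shift_op K 0) (TS : op_mul T S = shift_op K 0).
Hypothesis dS : forall v, op_deriv v S = op_mul (B v) S - op_mul S (X v).

Definition wave := op_mul S (op_exp A).
(** The transpose of the operator behind the adjoint wave function; as a matrix it is e^(-A) T. *)
Definition wave_inv := op_adj (op_mul (op_adj T) (op_exp (- op_adj A))).

Let pA' := phaseN (phase_adj pA).
Let bE : bnd s (op_exp A) := bnd_exp (phase_nil pA).
Let E' := op_adj (op_exp (- op_adj A)).

Let bE' : bnd s E'.
Proof. by rewrite -[s]negbK; exact/bnd_adj/(bnd_exp (phase_nil pA')). Qed.

Let wave_invE : wave_inv = op_mul E' T.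
Proof. by rewrite /wave_inv op_adjM op_adjK. Qed.

Lemma bnd_wave : bnd s wave. Proof. exact: bndM. Qed.

Lemma bnd_wave_inv : bnd s wave_inv.
Proof. by rewrite wave_invE; exact: bndM. Qed.

Lemma op_eq1_wave : op_eq1 wave S.
Proof.
rewrite -[X in op_eq1 _ X]op_mulr1; apply: op_eq1M => //.
exact: op_eq1_exp (phase_nil pA).
Qed.

Lemma op_eq1_wave_inv : op_eq1 wave_inv T.
Proof.
rewrite wave_invE -[X in op_eq1 _ X]op_mul1; apply: op_eq1M => // k n.
rewrite /E' /op_adj (op_eq1_exp (phase_nil pA')).
by rewrite /shift_op oppr_eq0.
Qed.

(** The term [- op_mul S (X v)] in [dS] is cancelled by the derivative of the exponential, which
    leaves only [B v]. *)
Lemma deriv_wave v : op_deriv v wave = op_mul (B v) wave.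
Proof.
have [bBs bXs] := (band_bnd s (bB v), band_bnd s (phase_band pA v)).
rewrite (op_derivM v bS bE) dS.
rewrite (op_deriv_exp charK (phase_nil pA) (phase_band pA) (phase_deriv pA)
  (phase_comm pA)).
rewrite (op_mulDl (bndM bBs bS) (bndN (bndM bS bXs)) bE) op_mulNl.
by rewrite (op_mulA bBs bS bE) (op_mulA bS bXs bE) subrK.
Qed.

(** Differentiating T S = 1 gives (dT) S = - T (dS); multiplication by T on the right then isolates
    dT. *)
Lemma deriv_inverse v : op_deriv v T = op_mul (X v) T - op_mul T (B v).
Proof.
have [bBs bXs] := (band_bnd s (bB v), band_bnd s (phase_band pA v)).
have bdT := bnd_deriv v bT.
have dTS : op_mul (op_deriv v T) S = - op_mul T (op_deriv v S).
  apply/eqP; rewrite -addr_eq0 -(op_derivM v bT bS) TS op_deriv_shift.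
  exact: eqxx.
rewrite -[LHS]op_mulr1 -ST -(op_mulA bdT bS bT) dTS dS.
rewrite (op_mulDr bT (bndM bBs bS) (bndN (bndM bS bXs))) op_mulNr.
rewrite -(op_mulA bT bS bXs) TS op_mul1 opprB.
rewrite (op_mulDl bXs (bndN (bndM bT (bndM bBs bS))) bT) op_mulNl.
rewrite (op_mulA bT (bndM bBs bS) bT) (op_mulA bBs bS bT) ST.
by rewrite op_mulr1.
Qed.

Lemma deriv_wave_inv v : op_deriv v wave_inv = - op_mul wave_inv (B v).
Proof.
have [bBs bXs] := (band_bnd s (bB v), band_bnd s (phase_band pA v)).
have dE' : op_deriv v E' = - op_mul E' (X v).
  rewrite /E' -op_adj_deriv (op_deriv_exp charK (phase_nil pA') (phase_band pA')
    (phase_deriv pA') (phase_comm pA')).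
  by rewrite op_mulNl op_adjN op_adjM op_adjK.
rewrite wave_invE (op_derivM v bE' bT) dE' deriv_inverse op_mulNl.
rewrite (op_mulDr bE' (bndM bXs bT) (bndN (bndM bT bBs))) op_mulNr.
rewrite (op_mulA bE' bXs bT) (op_mulA bE' bT bBs).
by rewrite addrA addNr add0r.
Qed.

(** At t = 0 both exponentials are 1, so inserting a power of Lambda between the wave matrices
    yields a dressed power, that is, a power of a Lax operator. *)
Lemma op_eq1_dressed j :
  op_eq1 (op_mul wave (op_mul (shift_op K j) wave_inv))
    (op_mul (op_mul S (shift_op K j)) T).
Proof.
rewrite (op_mulA bS (bnd_shift K s j) bT); apply: op_eq1M.
  exact: op_eq1_wave.
by apply: op_eq1M => //; exact: op_eq1_wave_inv.
Qed.

Lemma op_eq1_waveV : op_eq1 (op_mul wave wave_inv) (shift_op K 0).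
Proof. by have := op_eq1_dressed 0; rewrite op_mul1 op_mulr1 ST. Qed.

End WavePair.

Lemma op_pow_dress s S T j p : bnd s S -> bnd s T ->
  op_mul S T = shift_op K 0 -> op_mul T S = shift_op K 0 ->
  op_pow (op_mul (op_mul S (shift_op K j)) T) p =
  op_mul (op_mul S (shift_op K (j * p%:Z))) T.
Proof.
move=> bS bT ST TS; have bsh i := @bnd_shift K s i.
elim: p => [|p IH]; first by rewrite mulr0 op_mulr1 ST.
rewrite -[LHS]/(op_mul (op_mul (op_mul S (shift_op K j)) T) (op_pow _ p)) IH.
have [bSj bSp] := (bndM bS (bsh j), bndM bS (bsh (j * p%:Z))).
rewrite (op_mulA bSj bT (bndM bSp bT)) -(op_mulA bT bSp bT).
rewrite -(op_mulA bT bS (bsh _)).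
rewrite TS op_mul1 -(op_mulA bSj (bsh _) bT) (op_mulA bS (bsh _) (bsh _)).
by rewrite shift_opD intS mulrDr mulr1.
Qed.

Lemma op_ge0D_lt0 A : op_ge0 A + op_lt0 A = A.
Proof.
apply: opP => k n; rewrite -[LHS]/(op_ge0 A k n + op_lt0 A k n) /op_ge0 /op_lt0.
by case: ltP => _; rewrite ?addr0 ?add0r.
Qed.

Lemma band_ge0 A : bnd true A -> band (op_ge0 A).
Proof.
move=> bA; split=> d.
  have [a Aa] := bA d; exists a => k n ka; rewrite /op_ge0.
  by case: ifP => // _; exact: Aa.
by exists 0%N => k n; rewrite /op_ge0 /dir; case: ifP => //; lia.
Qed.

Lemma band_lt0 A : bnd false A -> band (op_lt0 A).
Proof.
move=> bA; split=> d; last first.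
  have [a Aa] := bA d; exists a => k n ka; rewrite /op_lt0.
  by case: ifP => // _; exact: Aa.
by exists 0%N => k n; rewrite /op_lt0 /dir; case: ifP => //; lia.
Qed.

(** The half column cut at [p] reproduces, up to sign, the sum over i >= 0 in [iotaL]; [colop_lt]
    does the same for [iotaLV]. *)
Lemma colop_ge V q p k :
  op_mul V (colop (>= p) q p) (p - k) k =
  fps_sum (fun l : nat => V (p + l%:Z - k) k * q (p + l%:Z)).
Proof.
rewrite -(fps_sum_int_ge p (fun x => V (x - k) k * q x)).
rewrite [LHS](fps_sum_reindexD k); apply: eq_fps_sum => x; rewrite /colop.
rewrite (_ : k + (x - k) = x); last by lia.
rewrite (_ : x + (p - k - (x - k)) = p) ?eqxx /=; last by lia.
by case: ifP; rewrite ?mulr0.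
Qed.

Lemma colop_lt V q p k :
  op_mul V (colop (< p) q p) (p - k) k =
  fps_sum (fun l : nat => V (p - l.+1%:Z - k) k * q (p - l.+1%:Z)).
Proof.
rewrite -(fps_sum_int_lt p (fun x => V (x - k) k * q x)).
rewrite [LHS](fps_sum_reindexD k); apply: eq_fps_sum => x; rewrite /colop.
rewrite (_ : k + (x - k) = x); last by lia.
rewrite (_ : x + (p - k - (x - k)) = p) ?eqxx /=; last by lia.
by case: ifP; rewrite ?mulr0.
Qed.

End Dressing.

(** * Residues *)

Section Residues.
Variable K : fieldType.
Local Notation tfun := (fps tvar K).
Implicit Types (W Y : op K) (q r : int -> tfun) (m : {cmonom tvar}) (n p : int).

Lemma op_entry (A : op K) k k' n n' : k = k' -> n = n' -> A k n = A k' n'.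
Proof. by move=> -> ->. Qed.

Lemma zresE a F G m m' : zres a F G m m' =
  \sum_(i \in [set: int]) fcoef (F i : tfun) m *
    fcoef (G (-1 - a - i) : tfun) m'.
Proof. by []. Qed.

(** The exponent of z in [act_z W n] is a column index of [W], and that of 1/z in [act_zV Y p] is a
    row index of the transpose of [Y]. Taking the residue contracts the two, and z^(a+1) becomes
    Lambda^(a+1) between the matrices. *)
Lemma zres_wave a W Y n p m m' :
  zres a (act_z W n) (act_zV Y p) m m' =
  pair W (op_mul (shift_op K (a + 1)) (op_adj Y)) m m' n p.
Proof.
rewrite zresE; apply: eq_fsbigr => i _.
rewrite /act_z /act_zV op_shiftlE /op_adj.
by congr (_ * fcoef (Y _ _) _); lia.
Qed.

Lemma zres_iotaL W Y q n p m m' :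
  zres (-1) (act_z W n)
    (iotaL (fun j k => act_zV Y (j + 1 - 1) k * q j) p) m m' =
  - pair W (op_mul (op_adj Y) (colop (>= p) q p)) m m' n p.
Proof.
rewrite -pairNr zresE; apply: eq_fsbigr => i _; congr (_ * fcoef _ _).
rewrite -[RHS]/(- (op_mul _ _ _ _)) colop_ge /iotaL; congr (- _).
apply: eq_fps_sum => l; rewrite /act_zV /op_adj.
by apply: congr2; [apply: op_entry; lia|].
Qed.

Lemma zres_iotaLV W Y q n p m m' :
  zres (-1) (act_z W n)
    (iotaLV (fun j k => act_zV Y (j + 1 - 1) k * q j) p) m m' =
  pair W (op_mul (op_adj Y) (colop (< p) q p)) m m' n p.
Proof.
rewrite zresE; apply: eq_fsbigr => i _; congr (_ * fcoef _ _).
rewrite colop_lt; apply: eq_fps_sum => l; rewrite /act_zV /op_adj.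
by apply: congr2; [apply: op_entry; lia|].
Qed.

(** Here the adjoint wave function comes first; its exponents of z are negated column indices,
    whence the reindexing by the opposite. *)
Lemma zresV_iotaL W Y q n p m m' :
  zres (-1) (act_zV Y n) (iotaL (fun j k => act_z W j k * q j) p) m m' =
  - pair Y (op_mul (op_adj W) (colop (>= p) q p)) m m' n p.
Proof.
rewrite -pairNr zresE (@reindex_fsbigT _ _ _ _ _ -%R); last first.
  by exists -%R; exact: opprK.
apply: eq_fsbigr => i _; rewrite /act_zV opprK; congr (_ * fcoef _ _).
rewrite -[RHS]/(- (op_mul _ _ _ _)) colop_ge /iotaL; congr (- _).
apply: eq_fps_sum => l; rewrite /act_z /op_adj.
by apply: congr2; [apply: op_entry; lia|].
Qed.

Lemma zresV_iotaLV W Y q n p m m' :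
  zres (-1) (act_zV Y n) (iotaLV (fun j k => act_z W j k * q j) p) m m' =
  pair Y (op_mul (op_adj W) (colop (< p) q p)) m m' n p.
Proof.
rewrite zresE (@reindex_fsbigT _ _ _ _ _ -%R); last first.
  by exists -%R; exact: opprK.
apply: eq_fsbigr => i _; rewrite /act_zV opprK; congr (_ * fcoef _ _).
rewrite colop_lt; apply: eq_fps_sum => l; rewrite /act_z /op_adj.
by apply: congr2; [apply: op_entry; lia|].
Qed.

Lemma sum_tens (J : Type) (l : seq J) (q r : J -> tfun) m m' :
  (\sum_(j <- l) tens (q j) (r j)) m m' =
  \sum_(j <- l) fcoef (q j) m * fcoef (r j) m'.
Proof. by elim: l => [|j l IH]; rewrite ?big_nil // !big_cons -IH. Qed.

Lemma tfun2P (f g : tfun2 K) : (forall m m', f m m' = g m m') -> f = g.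
Proof. by move=> fg; apply/funext => m; apply/funext. Qed.

End Residues.

(** * Assembly of the three identities *)

Theorem theorem9 (K : fieldType) (charK : [pchar K] =i pred0)
  (M N m : nat) (M_gt0 : (0 < M)%N) (N_gt0 : (0 < N)%N) (m_gt0 : (0 < m)%N)
  (L1 L2 S1 S2 : op K) (q r : 'I_m -> int -> fps tvar K)
  (* L_1 = Lambda + sum_(i >= 0) a_i Lambda^(-i), L_2 = sum_(i >= -1) b_i Lambda^i *)
  (L1_lead : forall n, L1 1 n = 1)
  (L1_supp : forall k n, 1 < k -> L1 k n = 0)
  (L2_supp : forall k n, k < -1 -> L2 k n = 0)
  (constraint : op_pow L1 M = op_pow L2 N + \sum_(l < m) op_biinf (q l) (r l))
  (lax1 : forall p, (0 < p)%N ->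
     op_deriv (t1 p) L1 = op_comm (op_ge0 (op_pow L1 p)) L1 /\
     op_deriv (t1 p) L2 = op_comm (op_ge0 (op_pow L1 p)) L2)
  (lax2 : forall p, (0 < p)%N ->
     op_deriv (t2 p) L1 = op_comm (op_lt0 (op_pow L2 p)) L1 /\
     op_deriv (t2 p) L2 = op_comm (op_lt0 (op_pow L2 p)) L2)
  (q_t1 : forall p i n, (0 < p)%N ->
     fps_deriv (t1 p) (q i n) = op_act (op_ge0 (op_pow L1 p)) (q i) n)
  (q_t2 : forall p i n, (0 < p)%N ->
     fps_deriv (t2 p) (q i n) = op_act (op_lt0 (op_pow L2 p)) (q i) n)
  (r_t1 : forall p i n, (0 < p)%N ->
     fps_deriv (t1 p) (r i n) =
     - op_act (op_adj (op_ge0 (op_translate (-1) (op_pow L1 p)))) (r i) n)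
  (r_t2 : forall p i n, (0 < p)%N ->
     fps_deriv (t2 p) (r i n) =
     - op_act (op_adj (op_lt0 (op_translate (-1) (op_pow L2 p)))) (r i) n)
  (* S_1 = 1 + sum_(j >= 1) w_j Lambda^(-j), S_2 = sum_(j >= 0) v_j Lambda^j *)
  (S1_lower : op_lower S1)
  (S1_lead : forall n, S1 0 n = 1)
  (S2_upper : op_upper S2)
  (S2_lead : forall n, S2 0 n \is a GRing.unit)
  (L1_dress : L1 = op_mul (op_mul S1 (shift_op K 1)) (op_inv (@op_lower K) S1))
  (L2_dress : L2 = op_mul (op_mul S2 (shift_op K (-1))) (op_inv (@op_upper K) S2))
  (S1_t1 : forall p, (0 < p)%N ->
     op_deriv (t1 p) S1 = - op_mul (op_lt0 (op_pow L1 p)) S1)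
  (S1_t2 : forall p, (0 < p)%N ->
     op_deriv (t2 p) S1 = op_mul (op_lt0 (op_pow L2 p)) S1)
  (S2_t1 : forall p, (0 < p)%N ->
     op_deriv (t1 p) S2 = op_mul (op_ge0 (op_pow L1 p)) S2)
  (S2_t2 : forall p, (0 < p)%N ->
     op_deriv (t2 p) S2 = - op_mul (op_ge0 (op_pow L2 p)) S2) :
  forall (n' n'' : int) (i : 'I_m),
  [/\ \sum_(l < m) tens (q l n') (r l n'') =
        zres (M%:Z - 1) (psi1 S1 n') (psi1s S1 n'')
        - zres (- N%:Z - 1) (psi2 S2 n') (psi2s S2 n''),
      tens (q i n') 1 =
        - zres (-1) (psi1 S1 n')
            (iotaL (fun n k => psi1s S1 (n + 1) k * q i n) n'')
        + zres (-1) (psi2 S2 n')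
            (iotaLV (fun n k => psi2s S2 (n + 1) k * q i n) n'')
    & tens (r i n') 1 =
        zres (-1) (psi1s S1 n')
            (iotaLV (fun n k => psi1 S1 n k * r i (n + 1)) n'')
        - zres (-1) (psi2s S2 n')
            (iotaL (fun n k => psi2 S2 n k * r i (n + 1)) n'')].
Proof.
pose T1 := op_inv (@op_lower K) S1; pose T2 := op_inv (@op_upper K) S2.
(* If [T1] were the default 0 of [op_inv], the dressing formula would give L_1 = 0, against its
   leading coefficient 1. *)
have [T1_lower ST1 TS1] : [/\ op_lower T1, op_mul S1 T1 = shift_op K 0 &
    op_mul T1 S1 = shift_op K 0].
  apply: op_invP; left; apply/eqP => T10; have := L1_lead 0.
  rewrite L1_dress T10 op_mul0r => /esym/eqP; exact/negP/oner_neq0.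
have [T2_upper ST2 TS2] : [/\ op_upper T2, op_mul S2 T2 = shift_op K 0 &
    op_mul T2 S2 = shift_op K 0].
  by apply: op_invP; right; exact: op_upper_inverse.
have [bS1 bT1] := (op_lower_bnd S1_lower, op_lower_bnd T1_lower).
have [bS2 bT2] := (op_upper_bnd S2_upper, op_upper_bnd T2_upper).
have powL1 p : op_pow L1 p = op_mul (op_mul S1 (shift_op K p%:Z)) T1.
  by rewrite L1_dress (op_pow_dress _ _ bS1 bT1 ST1 TS1) mul1r.
have powL2 p : op_pow L2 p = op_mul (op_mul S2 (shift_op K (- p%:Z))) T2.
  by rewrite L2_dress (op_pow_dress _ _ bS2 bT2 ST2 TS2) mulN1r.
have bL1 p : bnd true (op_pow L1 p).
  by rewrite powL1; apply: bndM => //; apply: bndM => //; exact: bnd_shift.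
have bL2 p : bnd false (op_pow L2 p).
  by rewrite powL2; apply: bndM => //; apply: bndM => //; exact: bnd_shift.
pose B (v : tvar) := match v with
  | inl j => op_ge0 (op_pow L1 j.+1) | inr j => op_lt0 (op_pow L2 j.+1) end.
have bB v : band (B v) by case: v => j; [exact: band_ge0|exact: band_lt0].
have inl_inj : injective (inl : nat -> tvar) by move=> x y [].
have inr_inj : injective (inr : nat -> tvar) by move=> x y [].
have pA1 : phase true (xi_op K inl) (xi_deriv K inl) by exact: phase_xi.
have pA2 : phase false (xi_opV K inr) (fun v => op_adj (xi_deriv K inr v)).
  exact: (phase_adj (phase_xi K inr_inj (fun=> erefl))).
have powS1 p : op_mul (op_pow L1 p) S1 = op_mul S1 (shift_op K p%:Z).
  by rewrite powL1 (op_mulA (bndM bS1 (bnd_shift _ _ _)) bT1 bS1) TS1 op_mulr1.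
have powS2 p : op_mul (op_pow L2 p) S2 = op_mul S2 (shift_op K (- p%:Z)).
  by rewrite powL2 (op_mulA (bndM bS2 (bnd_shift _ _ _)) bT2 bS2) TS2 op_mulr1.
(* Common form of the Sato equations. For t^(1) it follows from -(L_1^p)_(< 0) = (L_1^p)_(>= 0) -
   L_1^p and L_1^p S_1 = S_1 Lambda^p; the times t^(2) do not occur in the exponent. *)
have dS1 v : op_deriv v S1 = op_mul (B v) S1 - op_mul S1 (xi_deriv K inl v).
  case: v => j; last first.
    by rewrite [xi_deriv _ _ _]xi_deriv0 // op_mul0r subr0
      -[inr j]/(t2 j.+1) S1_t2.
  rewrite xi_deriv_tv // -powS1 -[inl j]/(t1 j.+1) S1_t1 //.
  rewrite -[in X in _ - X](op_ge0D_lt0 (op_pow L1 j.+1)).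
  have [bge blt] : band (B (inl j)) /\ bnd true (op_lt0 (op_pow L1 j.+1)).
    split; first exact: bB.
    move=> d; have [a La] := bL1 j.+1 d; exists a => k n ka; rewrite /op_lt0.
    by case: ifP => // _; exact: La.
  by rewrite (op_mulDl (band_bnd true bge) blt bS1) opprD addrA subrr add0r.
have dS2 v : op_deriv v S2 =
    op_mul (B v) S2 - op_mul S2 (op_adj (xi_deriv K inr v)).
  case: v => j.
    rewrite [xi_deriv _ _ _]xi_deriv0 // -[op_adj 0]/(0 : op K).
    by rewrite op_mul0r subr0 -[inl j]/(t1 j.+1) S2_t1.
  rewrite xi_deriv_tv // op_adj_shift -powS2 -[inr j]/(t2 j.+1) S2_t2 //.
  rewrite -[in X in _ - X](op_ge0D_lt0 (op_pow L2 j.+1)).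
  have [blt bge] : band (B (inr j)) /\ bnd false (op_ge0 (op_pow L2 j.+1)).
    split; first exact: bB.
    move=> d; have [a La] := bL2 j.+1 d; exists a => k n ka; rewrite /op_ge0.
    by case: ifP => // _; exact: La.
  by rewrite (op_mulDl bge (band_bnd false blt) bS2) opprD addrCA subrr addr0.
pose W1 := wave (xi_op K inl) S1; pose V1 := wave_inv (xi_op K inl) T1.
pose W2 := wave (xi_opV K inr) S2; pose V2 := wave_inv (xi_opV K inr) T2.
have bW1 : bnd true W1 := bnd_wave pA1 bS1.
have bV1 : bnd true V1 := bnd_wave_inv pA1 bT1.
have bW2 : bnd false W2 := bnd_wave pA2 bS2.
have bV2 : bnd false V2 := bnd_wave_inv pA2 bT2.
have dW1 v : op_deriv v W1 = op_mul (B v) W1.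
  exact: (deriv_wave charK pA1 bB bS1 dS1).
have dW2 v : op_deriv v W2 = op_mul (B v) W2.
  exact: (deriv_wave charK pA2 bB bS2 dS2).
have dV1 v : op_deriv v V1 = - op_mul V1 (B v).
  exact: (deriv_wave_inv charK pA1 bB bS1 bT1 ST1 TS1 dS1).
have dV2 v : op_deriv v V2 = - op_mul V2 (B v).
  exact: (deriv_wave_inv charK pA2 bB bS2 bT2 ST2 TS2 dS2).
have WV1 : op_eq1 (op_mul W1 V1) (shift_op K 0) := op_eq1_waveV pA1 bS1 bT1 ST1.
have WV2 : op_eq1 (op_mul W2 V2) (shift_op K 0) := op_eq1_waveV pA2 bS2 bT2 ST2.
have D1 : op_eq1 (op_mul W1 (op_mul (shift_op K M%:Z) V1)) (op_pow L1 M).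
  by rewrite powL1; exact: (op_eq1_dressed pA1 bS1 bT1).
have D2 : op_eq1 (op_mul W2 (op_mul (shift_op K (- N%:Z)) V2)) (op_pow L2 N).
  by rewrite powL2; exact: (op_eq1_dressed pA2 bS2 bT2).
(* The adjoint wave function at n'' is row n'' - 1 of its matrix, so r is shifted to match: r_(n'')
   is [rho] at n'' - 1. *)
pose rho l n := r l (n + 1).
have Bq l : solution B (q l).
  by case=> j n; [exact: (q_t1 j.+1)|exact: (q_t2 j.+1)].
have Brho l : solution (fun v => - op_adj (B v)) (rho l).
  (* The translation by -1 in the equations for r is absorbed by the shift in [rho]. *)
  have actE C n : op_act (op_adj (op_translate (-1) C)) (r l) (n + 1) =
      op_act (op_adj C) (rho l) n.
    apply: eq_fps_sum => i; rewrite /op_adj /op_translate /rho.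
    by apply: congr2; [apply: op_entry|congr r]; lia.
  move=> v n.
  rewrite [RHS](_ : _ = - op_act (op_adj (B v)) (rho l) n); last first.
    by rewrite -fps_sumN; apply: eq_fps_sum => i; rewrite -mulNr.
  case: v => j; rewrite -actE.
    exact: (r_t1 j.+1).
  exact: (r_t2 j.+1).
pose Y1 := op_mul (op_adj T1) (op_exp (- xi_opV K inl)).
pose Y2 := op_mul (op_adj T2) (op_exp (- xi_op K inr)).
have VY1 : V1 = op_adj Y1 by [].
have VY2 : V2 = op_adj Y2.
  by rewrite /V2 /wave_inv -[xi_opV K inr]/(op_adj (xi_op K inr)) op_adjK.
have psi1sE n : psi1s S1 n = act_zV Y1 (n - 1) by [].
have psi2sE n : psi2s S2 n = act_zV Y2 (n - 1) by [].
have psi1E n : psi1 S1 n = act_z W1 n by [].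
have psi2E n : psi2 S2 n = act_z W2 n by [].
have iota1E f : (fun n k => psi1s S1 (n + 1) k * f n) =
    (fun n k => act_zV Y1 (n + 1 - 1) k * f n) by [].
have iota2E f : (fun n k => psi2s S2 (n + 1) k * f n) =
    (fun n k => act_zV Y2 (n + 1 - 1) k * f n) by [].
have iota3E f : (fun n k => psi1 S1 n k * f (n + 1)) =
    (fun n k => act_z W1 n k * f (n + 1)) by [].
have iota4E f : (fun n k => psi2 S2 n k * f (n + 1)) =
    (fun n k => act_z W2 n k * f (n + 1)) by [].
clearbody W1 V1 W2 V2 Y1 Y2.
move=> n' n'' i; split; apply: tfun2P => m1 m2.
- rewrite -[RHS]/(zres _ _ _ m1 m2 - zres _ _ _ m1 m2).
  rewrite psi1sE psi2sE psi1E psi2E !zres_wave -VY1 -VY2 !subrK sum_tens.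
  have bsh s j := @bnd_shift K s j.
  (* [B v] multiplies [V] on the right, so a constant left factor Lambda^j preserves the
     equation. *)
  have dshV j s V : bnd s V -> (forall v, op_deriv v V = - op_mul V (B v)) ->
      forall v, op_deriv v (op_mul (shift_op K j) V) =
        - op_mul (op_mul (shift_op K j) V) (B v).
    move=> bV dV v; have bBs := band_bnd s (bB v).
    by rewrite (op_derivM v (bsh s j) bV) op_deriv_shift op_mul0l add0r dV
       op_mulNr (op_mulA (bsh s j) bV bBs).
  rewrite (@bilinear_identity _ charK B true false W1 _ W2
    (op_mul (shift_op K (- N%:Z)) V2) m q rho) //.
  + rewrite [_ + \sum_(l < m) _]addrC addrK; apply: eq_bigr => l _.
    by rewrite /rho subrK.
  + exact: bndM.
  + exact: bndM.
  + exact: (dshV _ _ _ bV1 dV1).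
  + exact: (dshV _ _ _ bV2 dV2).
  + move=> n p; rewrite !pair11.
    rewrite [LHS]D1 [X in _ = X + _]D2 constraint fcoefD; congr (_ + _).
    have -> : (\sum_(l < m) op_biinf (q l) (r l)) (p - n) n =
        \sum_(l < m) op_biinf (q l) (r l) (p - n) n.
      by elim: (index_enum _) => [|l s IH]; rewrite ?big_nil // !big_cons -IH.
    rewrite fcoef_sum; apply: eq_bigr => l _; rewrite fcoefM1 /rho.
    by congr (_ * fcoef (r l _) _); lia.
- rewrite -[RHS]/(- zres _ _ _ m1 m2 + zres _ _ _ m1 m2).
  rewrite psi1E psi2E iota1E iota2E zres_iotaL zres_iotaLV opprK -VY1 -VY2.
  by rewrite (propagator_column charK bB bW1 bV1 bW2 bV2 dW1 dW2 dV1 dV2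
    WV1 WV2 (Bq i)).
rewrite -[RHS]/(zres _ _ _ m1 m2 - zres _ _ _ m1 m2).
rewrite psi1sE psi2sE iota3E iota4E -/(rho i).
rewrite zresV_iotaL zresV_iotaLV opprK addrC.
have dY V : (forall v, op_deriv v V = - op_mul V (B v)) ->
    forall v, op_deriv v (op_adj V) = op_mul (- op_adj (B v)) (op_adj V).
  by move=> dV v; rewrite -op_adj_deriv dV op_adjN op_adjM op_mulNl.
have dZ W : (forall v, op_deriv v W = op_mul (B v) W) ->
    forall v, op_deriv v (op_adj W) = - op_mul (op_adj W) (- op_adj (B v)).
  by move=> dW v; rewrite -op_adj_deriv dW op_adjM op_mulNr opprK.
have YZ W V : op_eq1 (op_mul W V) (shift_op K 0) ->
    op_eq1 (op_mul (op_adj V) (op_adj W)) (shift_op K 0).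
  by move=> WV k n; rewrite -op_adjM /op_adj WV /shift_op oppr_eq0.
have [YE1 YE2] : Y1 = op_adj V1 /\ Y2 = op_adj V2 by rewrite VY1 VY2 !op_adjK.
(* Transposition reverses the direction of Lambda, so the matrices of index 2 take the place of
   those of index 1 and conversely. The generators become the opposite adjoints of [B v], and
   [rho i] replaces q. *)
rewrite YE1 YE2 (propagator_column charK (B := fun v => - op_adj (B v)) _
  (bnd_adj bV2) (bnd_adj bW2) (bnd_adj bV1) (bnd_adj bW1)
  (dY _ dV2) (dY _ dV1) (dZ _ dW2) (dZ _ dW1) (YZ _ _ WV2) (YZ _ _ WV1)
  (Brho i)).
  by rewrite /rho subrK.
by move=> v; apply/bandN/band_adj.
Qed.
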